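(* Let $A=A^T\succ0$ in $\mathbb R^{n\times n}$ and $b\in\mathbb R^n$, $b\ne0$, have floating-point entries and satisfy $$\tfrac12\le\|A\|_2\le1,\qquad \tfrac12\le\|b\|_2\le1 .$$ Let $x_0$ be a floating-point vector and let $0<\varepsilon\le1$. Let $\chi,\varepsilon_0,q,d,G,R,P,U,C,N,\delta,X,V,C_{\rm s},N_{\rm s},\rho_{\rm s},E_{\rm s},H$ be the constants defined in the context. Suppose that scalar rounding satisfies $|\operatorname{fl}(z)-z|\le u|z|+\omega$ (with $\omega\ge0$), that $$2(u+\omega)C^N\le\delta,\qquad E_{\rm s}\le\frac{\varepsilon_0^2}{256},$$ and that the range assumption in the context holds. Then the CG algorithm with true-residual stopping test described in the context can be evaluated without a zero or nonfinite divisor until its stopping test succeeds. The test succeeds at an index $i_*\le n$, and the returned vector $\widehat x_{i_*}$ is nonzero and satisfies $$\eta(\widehat x_{i_*})\le\eta_A(\widehat x_{i_*})\le\varepsilon_0\le\varepsilon .$$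
   Context: Backward errors: $\eta(x)=\dfrac{\|b-Ax\|_2}{\|A\|_2\|x\|_2+\|b\|_2}$, and for $x\ne0$, $\eta_A(x)=\dfrac{\|b-Ax\|_2}{\|A\|_2\|x\|_2}$. $\kappa_2(A)=\|A\|_2\|A^{-1}\|_2$. Constants: $$\chi=\max\left\{1,\frac{\|b-Ax_0\|_2}{\|b\|_2}\right\},\quad \varepsilon_0=2^{\lfloor\log_2\varepsilon\rfloor},\quad q=\frac{\varepsilon_0}{10},\quad d=\frac{\varepsilon_0^2}{200\,\kappa_2(A)},\quad G=\kappa_2(A),$$ $$R=\sqrt{\kappa_2(A)}\,\chi,\qquad P=\kappa_2(A)\chi,$$ $$U=2+d^{-1}+\kappa_2(A)\chi^2+2\kappa_2(A)(1+\chi)+P^2+(2\kappa_2(A)+G+2)P,$$ $$C=\frac{8U^2}{d^2},\qquad N=2n^3+13n^2-n,\qquad \delta=\min\left\{1,\frac d2,\frac{\varepsilon_0}{20\sqrt n}\right\},$$ $$X=2\kappa_2(A)(1+\chi)+1,\quad V=4(2+X)^2,\quad C_{\rm s}=8V^2,\quad N_{\rm s}=2n^2+4n+2,$$ $$\rho_{\rm s}=2u(V+1)^2+\omega,\qquad E_{\rm s}=2\rho_{\rm s}C_{\rm s}^{N_{\rm s}},$$ $$H=\max\left\{2(U+1),\ (U+1)^2+(U+1),\ \frac{2(U+1)}{d},\ 2(V+1)^2\right\}.$$ Arithmetic: $u$ is the unit roundoff, $\operatorname{fl}$ is scalar round-to-nearest. Every dense matrix row and inner product is accumulated from left to right. Products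 and partial sums are stored separately. In an AXPY (vector update $y+\alpha x$), each product is rounded before the addition, and each quotient is formed by one division. A stored squared residual norm may be reused. A fused multiply-add may replace one product-add pair by its correctly rounded result. Algorithm (Hestenes--Stiefel CG with a true-residual stopping test): set $r_0=\operatorname{fl}(b-Ax_0)$, $p_0=r_0$. For $i=0,1,\dots$: (1) evaluate in floating point, directly from the stored iterate $\widehat x_i$ (the stored $x_i$) and without modifying the CG state, a stored value $\widehat\Phi_i$ of $\Phi(\widehat x_i)=\|b-A\widehat x_i\|_2^2-\frac{\varepsilon_0^2}{4}\|\widehat x_i\|_2^2$ (the residual is recomputed, the two squared norms are formed, the second is scaled and subtracted); (2) if $\widehat\Phi_i\le-\varepsilon_0^2/256$, return $\widehat x_i$ (the stopping test succeeds); (3) if $r_i=0$, terminate with a zero stored residual; (4) otherwise compute $$q_i=\operatorname{fl}(Ap_i),\quad a_i^{\rm cg}=\operatorname{fl}\!\left(\frac{\operatorname{fl}(\langle r_i,r_i\rangle)}{\operatorname{fl}(\langle q_i,p_i\rangle)}\right),\quad x_{i+1}=\operatorname{fl}(x_i+a_i^{\rm cg}p_i),\quad r_{i+1}=\operatorname{fl}(r_i-a_i^{\rm cg}q_i),$$ $$b_{i+1}^{\rm cg}=\operatorname{fl}\!\left(\frac{\operatorname{fl}(\langle r_{i+1},r_{i+1}\rangle)}{\operatorname{fl}(\langle r_i,r_i\rangle)}\right),\quad p_{i+1}=\operatorname{fl}(r_{i+1}+b_{i+1}^{\rm cg}p_i).$$ Range assumption: the quantities $\varepsilon_0$, $\varepsilon_0^2/4$,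 $\varepsilon_0^2/256$ are represented exactly; $A$, $b$, $x_0$ are stored floating-point values; every exact scalar result of the algorithm and its stopping test that has magnitude at most $H$ lies in the finite exponent range, so that $|\operatorname{fl}(z)-z|\le u|z|+\omega$ applies without overflow. *)

(* Defs.v *)
From mathcomp Require Import all_boot all_order all_algebra.
From mathcomp Require Import boolp classical_sets reals exp.

Set Implicit Arguments.
Unset Strict Implicit.
Unset Printing Implicit Defensive.

Import Order.TTheory GRing.Theory Num.Theory.

Local Open Scope classical_set_scope.
Local Open Scope ring_scope.

Section Norms.
Context {R : realType} {n : nat}.
Implicit Types (A : 'M[R]_n) (b x : 'cV[R]_n).

Definition norm2 x : R := Num.sqrt (\sum_(i < n) x i 0 ^+ 2).

Definition opnorm2 A : R := sup [set norm2 (A *m x) | x in [set x | norm2 x <= 1]].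

Definition kappa2 A : R := opnorm2 A * opnorm2 (invmx A).

Definition posdefmx A : Prop := forall x, x != 0 -> 0 < (x^T *m A *m x) 0 0.

Definition eta A b x : R := norm2 (b - A *m x) / (opnorm2 A * norm2 x + norm2 b).

Definition eta_A A b x : R := norm2 (b - A *m x) / (opnorm2 A * norm2 x).

End Norms.

Section Constants.
Context {R : realType} {n : nat}.
Variables (A : 'M[R]_n) (b x0 : 'cV[R]_n) (eps u omega : R).

Let kappa := kappa2 A.

Definition chi : R := Num.max 1 (norm2 (b - A *m x0) / norm2 b).

Definition eps0 : R := 2 ^ Num.floor (ln eps / ln 2).

Definition d_cst : R := eps0 ^+ 2 / (200 * kappa).

Definition G_cst : R := kappa.

Definition P_cst : R := kappa * chi.

Definition U_cst : R :=
  2 + d_cst^-1 + kappa * chi ^+ 2 + 2 * kappa * (1 + chi) + P_cst ^+ 2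
  + (2 * kappa + G_cst + 2) * P_cst.

Definition C_cst : R := 8 * U_cst ^+ 2 / d_cst ^+ 2.

Definition N_cst : nat := (2 * n ^ 3 + 13 * n ^ 2 - n)%N.

Definition delta_cst : R :=
  Num.min 1 (Num.min (d_cst / 2) (eps0 / (20 * Num.sqrt n%:R))).

Definition X_cst : R := 2 * kappa * (1 + chi) + 1.

Definition V_cst : R := 4 * (2 + X_cst) ^+ 2.

Definition Cs_cst : R := 8 * V_cst ^+ 2.

Definition Ns_cst : nat := (2 * n ^ 2 + 4 * n + 2)%N.

Definition rhos_cst : R := 2 * u * (V_cst + 1) ^+ 2 + omega.

Definition Es_cst : R := 2 * rhos_cst * Cs_cst ^+ Ns_cst.

Definition H_cst : R :=
  Num.max (2 * (U_cst + 1)) (Num.max ((U_cst + 1) ^+ 2 + (U_cst + 1))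
    (Num.max (2 * (U_cst + 1) / d_cst) (2 * (V_cst + 1) ^+ 2))).

End Constants.

Arguments N_cst n : clear implicits.
Arguments Ns_cst n : clear implicits.

(* [fl z] is [None] exactly when [z] lies outside the finite exponent range;
   otherwise it is a stored number nearest to [z], with any tie-breaking. *)
Record fp_system (R : realType) := FPSystem {
  fp_num : set R;
  fl : R -> option R;
  fp_num0 : fp_num 0;
  fp_numN : forall x, fp_num x -> fp_num (- x);
  fl_num : forall x, fp_num x -> fl x = Some x;
  fl_nearest : forall z y, fl z = Some y ->
    fp_num y /\ forall w, fp_num w -> `|y - z| <= `|w - z|
}.

(* A stored scalar. [fpval] is [None] when the scalar is nonfinite or undefined.
   [exacts] is the set of all exact scalar results (values before rounding)
   formed in its evaluation, from the input data on. *)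
Record stored (R : realType) := Stored { fpval : option R; exacts : set R }.

Definition input {R : realType} (x : R) : stored R := Stored (Some x) set0.

Section Arithmetic.
Context {R : realType}.
Variable F : fp_system R.
Implicit Types a x y z : stored R.

Definition round_exact (z : option R) (h : set R) : stored R :=
  if z is Some t then Stored (fl F t) (h `|` [set t]) else Stored None h.

Definition fadd x y : stored R :=
  round_exact (if (fpval x, fpval y) is (Some s, Some t) then Some (s + t) else None)
    (exacts x `|` exacts y).

Definition fsub x y : stored R :=
  round_exact (if (fpval x, fpval y) is (Some s, Some t) then Some (s - t) else None)
    (exacts x `|` exacts y).

Definition fmul x y : stored R :=
  round_exact (if (fpval x, fpval y) is (Some s, Some t) then Some (s * t) else None)
    (exacts x `|` exacts y).

(* Division by zero has no exact result, hence the explicit test. *)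
Definition fdiv x y : stored R :=
  round_exact
    (if (fpval x, fpval y) is (Some s, Some t) then
       if t == 0 then None else Some (s / t)
     else None)
    (exacts x `|` exacts y).

(* The Boolean [c] selects the fused operation: one rounding instead of two. *)
Definition fmuladd (c : bool) y a x : stored R :=
  if c then
    round_exact
      (if (fpval y, fpval a, fpval x) is (Some r, Some s, Some t)
       then Some (r + s * t) else None)
      (exacts y `|` exacts a `|` exacts x)
  else fadd y (fmul a x).

Definition fmulsub (c : bool) y a x : stored R :=
  if c then
    round_exact
      (if (fpval y, fpval a, fpval x) is (Some r, Some s, Some t)
       then Some (r - s * t) else None)
      (exacts y `|` exacts a `|` exacts x)
  else fsub y (fmul a x).

Section Vectors.
Context {n : nat}.
Implicit Types (v w : 'I_n -> stored R) (c : 'I_n -> bool).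

(* Accumulated from left to right; the first product is the first partial sum,
   so [c] is not read at the first index. *)
Definition fdot c v w : stored R :=
  if enum 'I_n is j0 :: js then
    foldl (fun s j => fmuladd (c j) s (v j) (w j)) (fmul (v j0) (w j0)) js
  else input 0.

Definition fmv (c : 'I_n -> 'I_n -> bool) (A : 'M[R]_n) v : 'I_n -> stored R :=
  fun i => fdot (c i) (fun j => input (A i j)) v.

Definition fresidual (c : 'I_n -> 'I_n -> bool) (A : 'M[R]_n) (b : 'cV[R]_n) v :
    'I_n -> stored R :=
  fun i => fsub (input (b i 0)) (fmv c A v i).

End Vectors.
End Arithmetic.

(* The choices left open to an implementation at iteration i: which product-add
   pairs are fused, and which squared residual norms are reused. *)
Record iter_choice (n : nat) := IterChoice {
  test_fma_Ax : 'I_n -> 'I_n -> bool;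
  test_fma_rr : 'I_n -> bool;
  test_fma_xx : 'I_n -> bool;
  test_fma_sub : bool;
  reuse_num : bool;           (* <r_i,r_i> in a_i: reuse the value from b_i *)
  fma_num : 'I_n -> bool;     (* otherwise, recompute it *)
  fma_Ap : 'I_n -> 'I_n -> bool;
  fma_den : 'I_n -> bool;
  fma_x : 'I_n -> bool;
  fma_r : 'I_n -> bool;
  fma_rr : 'I_n -> bool;
  reuse_old : bool;           (* <r_i,r_i> in b_(i+1): reuse the value from a_i *)
  fma_old : 'I_n -> bool;     (* otherwise, recompute it *)
  fma_p : 'I_n -> bool
}.

Record cg_choice (n : nat) := CGChoice {
  init_fma_Ax : 'I_n -> 'I_n -> bool;
  init_fma_rr : 'I_n -> bool;
  iter_of : nat -> iter_choice n
}.

(* [cg_rr] is the squared norm of r_i stored when b_i was formed (for i = 0,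
   when r_0 was formed). *)
Record cg_state (R : realType) (n : nat) := CGState {
  cg_x : 'I_n -> stored R;
  cg_r : 'I_n -> stored R;
  cg_p : 'I_n -> stored R;
  cg_rr : stored R
}.

Section CG.
Context {R : realType} {n : nat}.
Variables (F : fp_system R) (ch : cg_choice n).
Variables (A : 'M[R]_n) (b x0 : 'cV[R]_n) (eps : R).

Section Step.
Variables (c : iter_choice n) (s : cg_state R n).

Definition step_num : stored R :=
  if reuse_num c then cg_rr s else fdot F (fma_num c) (cg_r s) (cg_r s).

Definition step_q : 'I_n -> stored R := fmv F (fma_Ap c) A (cg_p s).

Definition step_den : stored R := fdot F (fma_den c) step_q (cg_p s).

Definition step_a : stored R := fdiv F step_num step_den.

Definition step_x : 'I_n -> stored R :=
  fun k => fmuladd F (fma_x c k) (cg_x s k) step_a (cg_p s k).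

Definition step_r : 'I_n -> stored R :=
  fun k => fmulsub F (fma_r c k) (cg_r s k) step_a (step_q k).

Definition step_rr : stored R := fdot F (fma_rr c) step_r step_r.

Definition step_old : stored R :=
  if reuse_old c then step_num else fdot F (fma_old c) (cg_r s) (cg_r s).

Definition step_b : stored R := fdiv F step_rr step_old.

Definition step_p : 'I_n -> stored R :=
  fun k => fmuladd F (fma_p c k) (step_r k) step_b (cg_p s k).

Definition cg_step : cg_state R n := CGState step_x step_r step_p step_rr.

(* The stored value of |b - A x|^2 - (eps0^2/4) |x|^2. *)
Definition test_value : stored R :=
  let res := fresidual F (test_fma_Ax c) A b (cg_x s) in
  fmulsub F (test_fma_sub c) (fdot F (test_fma_rr c) res res)
    (input (eps0 eps ^+ 2 / 4)) (fdot F (test_fma_xx c) (cg_x s) (cg_x s)).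

End Step.

Definition cg_init : cg_state R n :=
  let x := fun k => input (x0 k 0) in
  let r := fresidual F (init_fma_Ax ch) A b x in
  CGState x r r (fdot F (init_fma_rr ch) r r).

(* The state at index i, computed without regard to the stopping criteria;
   [cg_reached] tells whether the algorithm gets there. *)
Fixpoint cg_at (i : nat) : cg_state R n :=
  if i is j.+1 then cg_step (iter_of ch j) (cg_at j) else cg_init.

Definition cg_test (i : nat) : stored R := test_value (iter_of ch i) (cg_at i).

Definition cg_stop (i : nat) : bool :=
  if fpval (cg_test i) is Some phi then phi <= - (eps0 eps ^+ 2 / 256) else false.

Definition cg_zero_residual (i : nat) : bool :=
  [forall k, fpval (cg_r (cg_at i) k) == Some 0].

Definition cg_reached (i : nat) : Prop :=
  forall j, (j < i)%N -> ~~ cg_stop j /\ ~~ cg_zero_residual j.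

Definition cg_divisor_a (i : nat) : stored R := step_den (iter_of ch i) (cg_at i).

Definition cg_divisor_b (i : nat) : stored R := step_old (iter_of ch i) (cg_at i).

(* All exact scalar results of the algorithm and its stopping test up to and
   including the test at index i. *)
Definition cg_exacts (i : nat) : set R :=
  [set z | exacts (cg_test i) z \/
     exists k, [\/ exacts (cg_x (cg_at i) k) z, exacts (cg_r (cg_at i) k) z |
                   exacts (cg_p (cg_at i) k) z]].

End CG.

Definition finite_nonzero {R : realType} (x : stored R) : Prop :=
  exists2 t, fpval x = Some t & t != 0.

(* Main.v *)
Require Import Defs.
From mathcomp Require Import all_boot all_order all_algebra.
From mathcomp Require Import boolp classical_sets reals exp.
From mathcomp Require Import ring lra zify.

Set Implicit Arguments.
Unset Strict Implicit.
Unset Printing Implicit Defensive.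

Import Order.TTheory GRing.Theory Num.Theory.
Local Open Scope ring_scope.

(* In exact arithmetic the residuals are mutually orthogonal, so one of them
   vanishes after at most [n] steps. Let [m] be the first index at which the
   exact residual is smaller than [eps0 / 10]. Before [m] every divisor is at
   least [d], and all exact quantities are at most [U]; hence each rounded
   operation multiplies the distance to the exact run by at most [C], and the
   at most [N] nested operations keep it below [delta / 2]. In particular the
   stored residual does not vanish before [m], and at [m] the stored test value
   is at most [- eps0 ^+ 2 / 256]. Wherever the test succeeds, its own rounding
   error is at most [eps0 ^+ 2 / 800], so the residual of the stored iterate
   [x] is at most [eps0 / 2 * norm2 x <= eps0 * opnorm2 A * norm2 x]. *)

(** * Euclidean norm and positive definite matrices *)

Definition dot {R : realType} {n : nat} (x y : 'cV[R]_n) : R :=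
  \sum_(i < n) x i 0 * y i 0.

Section Euclid.
Context {R : realType} {n : nat}.
Implicit Types (A B : 'M[R]_n) (x y z : 'cV[R]_n) (a c : R).

Lemma dotE x y : dot x y = (x^T *m y) 0 0.
Proof. by rewrite mxE; apply: eq_bigr => i _; rewrite mxE. Qed.

Lemma dotC x y : dot x y = dot y x.
Proof. by apply: eq_bigr => i _; rewrite mulrC. Qed.

Lemma dotDl x y z : dot (x + y) z = dot x z + dot y z.
Proof. by rewrite -big_split; apply: eq_bigr => i _; rewrite mxE mulrDl. Qed.

Lemma dotZl a x y : dot (a *: x) y = a * dot x y.
Proof. by rewrite mulr_sumr; apply: eq_bigr => i _; rewrite mxE mulrA. Qed.

Lemma dotNl x y : dot (- x) y = - dot x y.
Proof. by rewrite -scaleN1r dotZl mulN1r. Qed.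

Lemma dotBl x y z : dot (x - y) z = dot x z - dot y z.
Proof. by rewrite dotDl dotNl. Qed.

Lemma dotDr x y z : dot x (y + z) = dot x y + dot x z.
Proof. by rewrite dotC dotDl !(dotC x). Qed.

Lemma dotZr a x y : dot x (a *: y) = a * dot x y.
Proof. by rewrite dotC dotZl dotC. Qed.

Lemma dotNr x y : dot x (- y) = - dot x y.
Proof. by rewrite dotC dotNl dotC. Qed.

Lemma dotBr x y z : dot x (y - z) = dot x y - dot x z.
Proof. by rewrite dotDr dotNr. Qed.

Lemma dot0l x : dot 0 x = 0.
Proof. by rewrite -(scale0r x) dotZl mul0r. Qed.

Lemma dot0r x : dot x 0 = 0.
Proof. by rewrite dotC dot0l. Qed.

Lemma dot_symmx A x y : A^T = A -> dot (A *m x) y = dot x (A *m y).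
Proof. by move=> As; rewrite !dotE trmx_mul As mulmxA. Qed.

Lemma dot_ge0 x : 0 <= dot x x.
Proof. by apply: sumr_ge0 => i _; rewrite -expr2 sqr_ge0. Qed.

Lemma dot_eq0 x : (dot x x == 0) = (x == 0).
Proof.
apply/eqP/eqP => [|->]; last exact: dot0l.
move=> /eqP; rewrite psumr_eq0 => [/allP h|i _]; last by rewrite -expr2 sqr_ge0.
apply/colP => i; rewrite mxE; apply/eqP.
by have := h i (mem_index_enum i); rewrite /= mulf_eq0 orbb.
Qed.

Lemma dot_gt0 x : (0 < dot x x) = (x != 0).
Proof. by rewrite lt_def dot_ge0 dot_eq0 andbT. Qed.

Lemma norm2_sqr x : norm2 x ^+ 2 = dot x x.
Proof.
rewrite sqr_sqrtr; first by apply: eq_bigr => i _; rewrite expr2.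
by apply: sumr_ge0 => i _; exact: sqr_ge0.
Qed.

Lemma norm2_ge0 x : 0 <= norm2 x.
Proof. exact: sqrtr_ge0. Qed.

Lemma norm2_gt0 x : (0 < norm2 x) = (x != 0).
Proof. by rewrite lt_def norm2_ge0 andbT -sqrf_eq0 norm2_sqr dot_eq0. Qed.

Lemma norm2_0 : norm2 (0 : 'cV[R]_n) = 0.
Proof. by apply/eqP; rewrite -sqrf_eq0 norm2_sqr dot0l. Qed.

Lemma posdefmxE A x : posdefmx A -> x != 0 -> 0 < dot x (A *m x).
Proof. by move=> Ap x0; rewrite dotE mulmxA; exact: Ap. Qed.

Lemma posdefmx_ge0 A x : posdefmx A -> 0 <= dot x (A *m x).
Proof.
move=> Ap; have [->|x0] := eqVneq x 0; first by rewrite dot0l.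
by rewrite ltW // posdefmxE.
Qed.

(** Expand the nonnegative energy of [t *: x - s *: y] with [t = dot y (A *m y)] and
    [s = dot x (A *m y)]: it equals [t] times the gap of the inequality, and [t > 0]. *)
Lemma cauchy_schwarz_posdef A x y : A^T = A -> posdefmx A ->
  dot x (A *m y) ^+ 2 <= dot x (A *m x) * dot y (A *m y).
Proof.
move=> As Ap; have [->|y0] := eqVneq y 0.
  by rewrite mulmx0 !dot0r expr0n mulr0.
have yy := posdefmxE Ap y0.
set s := dot x (A *m y); set t := dot y (A *m y).
have := posdefmx_ge0 (t *: x - s *: y) Ap.
rewrite mulmxBr -!scalemxAr !dotBl !dotBr !dotZl !dotZr.
rewrite -(dot_symmx y x) // (dotC _ x) -/s -/t.
rewrite -/t in yy.
have -> : t * (t * dot x (A *m x)) - t * (s * s) - (s * (t * s) - s * (s * t))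
  = t * (dot x (A *m x) * t - s ^+ 2) by ring.
by rewrite pmulr_rge0 // subr_ge0.
Qed.

Lemma cauchy_schwarz x y : `|dot x y| <= norm2 x * norm2 y.
Proof.
have p1 : posdefmx (1%:M : 'M[R]_n).
  by move=> v v0; rewrite mulmx1 -dotE dot_gt0.
have := cauchy_schwarz_posdef x y (trmx1 _ _) p1.
rewrite !mul1mx -!norm2_sqr -exprMn => h.
rewrite -(@ler_pXn2r _ 2) ?nnegrE ?normr_ge0 ?mulr_ge0 ?norm2_ge0 //.
by rewrite real_normK ?num_real.
Qed.

(** Controls every partial sum of an inner product at once, as left-to-right accumulation requires.
    It is Cauchy--Schwarz for the vectors of absolute values, which have the same norms. *)
Lemma cauchy_schwarz_abs x y :
  \sum_(i < n) `|x i 0 * y i 0| <= norm2 x * norm2 y.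
Proof.
pose f (v : 'cV[R]_n) : 'cV[R]_n := \col_i `|v i 0|.
have nf v : norm2 (f v) = norm2 v.
  congr Num.sqrt; apply: eq_bigr => i _.
  by rewrite mxE real_normK ?num_real.
rewrite -(nf x) -(nf y); apply: le_trans (cauchy_schwarz _ _).
apply: le_trans (ler_norm _); rewrite le_eqVlt; apply/orP; left; apply/eqP.
by apply: eq_bigr => i _; rewrite !mxE normrM.
Qed.

Lemma norm2D x y : norm2 (x + y) <= norm2 x + norm2 y.
Proof.
rewrite -(@ler_pXn2r _ 2) ?nnegrE ?addr_ge0 ?norm2_ge0 //.
rewrite sqrrD !norm2_sqr dotDl !dotDr (dotC y x).
by have := cauchy_schwarz x y; rewrite ler_norml => /andP[_]; lra.
Qed.

Lemma norm2Z a x : norm2 (a *: x) = `|a| * norm2 x.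
Proof.
apply/eqP; rewrite -(@eqrXn2 _ 2) ?mulr_ge0 ?norm2_ge0 //.
by rewrite exprMn real_normK ?num_real // !norm2_sqr dotZl dotZr; apply/eqP; ring.
Qed.

Lemma norm2N x : norm2 (- x) = norm2 x.
Proof. by rewrite -scaleN1r norm2Z normrN normr1 mul1r. Qed.

Lemma norm2B x y : norm2 (x - y) <= norm2 x + norm2 y.
Proof. by rewrite -(norm2N y) norm2D. Qed.

Lemma norm2_ge x i : `|x i 0| <= norm2 x.
Proof.
rewrite -(@ler_pXn2r _ 2) ?nnegrE ?norm2_ge0 // real_normK ?num_real //.
rewrite norm2_sqr /dot (bigD1 i) //= -expr2 lerDl.
by apply: sumr_ge0 => j _; rewrite -expr2 sqr_ge0.
Qed.

Lemma norm2_le_sqrt x e : 0 <= e -> (forall i, `|x i 0| <= e) ->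
  norm2 x <= Num.sqrt n%:R * e.
Proof.
move=> e0 xe.
rewrite -(@ler_pXn2r _ 2) ?nnegrE ?norm2_ge0 ?mulr_ge0 ?sqrtr_ge0 //.
rewrite norm2_sqr exprMn sqr_sqrtr // mulr_natl -{2}(card_ord n) -sumr_const.
apply: ler_sum => i _; rewrite -expr2 -real_normK ?num_real //.
by rewrite ler_pXn2r ?nnegrE.
Qed.

Lemma opnorm2_ub A x : norm2 (A *m x) <= opnorm2 A * norm2 x.
Proof.
have [->|x0] := eqVneq x 0.
  by rewrite mulmx0 norm2_0 mulr0.
have xp : 0 < norm2 x by rewrite norm2_gt0.
rewrite -ler_pdivrMr //; apply: ub_le_sup.
  (* [sup] dominates its set only if that set is bounded above; [sqrt n] times the sum of the row
     norms is a crude upper bound. *)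
  pose K := \sum_(i < n) norm2 (row i A)^T.
  exists (Num.sqrt n%:R * K) => _ [y /= y1 <-].
  have K0 : 0 <= K by apply: sumr_ge0 => i _; exact: norm2_ge0.
  apply: norm2_le_sqrt => // i.
  have -> : (A *m y) i 0 = dot (row i A)^T y.
    by rewrite mxE; apply: eq_bigr => j _; rewrite !mxE.
  apply: le_trans (cauchy_schwarz _ _) _.
  apply: (@le_trans _ _ (norm2 (row i A)^T)).
    by rewrite ler_piMr ?norm2_ge0.
  by rewrite /K (bigD1 i) //= lerDl; apply: sumr_ge0 => j _; exact: norm2_ge0.
exists ((norm2 x)^-1 *: x) => /=.
  by rewrite norm2Z ger0_norm ?invr_ge0 ?norm2_ge0 // mulVf // gt_eqF.
by rewrite -scalemxAr norm2Z ger0_norm ?invr_ge0 ?norm2_ge0 // mulrC.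
Qed.

Lemma opnorm2_ge0 A : (0 < n)%N -> 0 <= opnorm2 A.
Proof.
move=> n0; pose e : 'cV[R]_n := const_mx 1.
have e0 : 0 < norm2 e.
  rewrite norm2_gt0; apply/eqP => /colP /(_ (Ordinal n0)) /eqP.
  by rewrite !mxE oner_eq0.
by rewrite -(pmulr_lge0 _ e0); apply: le_trans (opnorm2_ub A e); exact: norm2_ge0.
Qed.

Lemma dot_opnorm2 A x : dot x (A *m x) <= opnorm2 A * dot x x.
Proof.
apply: le_trans (ler_norm _) _; apply: le_trans (cauchy_schwarz _ _) _.
rewrite mulrC -norm2_sqr expr2 mulrA ler_wpM2r ?norm2_ge0 //.
exact: opnorm2_ub.
Qed.

(** By symmetry a row is the image of a unit vector. Thus each entry of a matrix-vector product is
    an inner product of two bounded vectors. *)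
Lemma norm2_row A i : A^T = A -> norm2 (row i A)^T <= opnorm2 A.
Proof.
move=> As; have -> : (row i A)^T = A *m delta_mx i 0.
  by rewrite tr_row As colE.
apply: le_trans (opnorm2_ub _ _) _; rewrite -[leRHS]mulr1 ler_wpM2l //.
  by apply: opnorm2_ge0; apply: leq_ltn_trans (ltn_ord i).
rewrite -(@ler_pXn2r _ 2) ?nnegrE ?norm2_ge0 // norm2_sqr /dot (bigD1 i) //=.
rewrite big1 ?addr0 => [|j ji]; first by rewrite !mxE !eqxx mulr1 expr1n.
by rewrite !mxE (negPf ji) mul0r.
Qed.

(** A nonzero row [v] in the left kernel of [A^T] would satisfy [A *m v^T = 0] and so have zero
    energy. *)
Lemma posdefmx_unit A : posdefmx A -> A \in unitmx.
Proof.
move=> Ap; rewrite -unitmx_tr -row_free_unit -kermx_eq0.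
apply/eqP/row_matrixP => i.
rewrite row0; apply/eqP; apply: contraT => v0.
have k : row i (kermx A^T) *m A^T = 0.
  by rewrite -row_mul mulmx_ker row0.
move: k v0; set v := row _ _ => k v0.
have vt0 : v^T != 0 by rewrite trmx_eq0.
have := Ap _ vt0.
by rewrite trmxK -[A]trmxK -mulmxA -trmx_mul k trmx0 mulmx0 mxE ltxx.
Qed.

Lemma posdefmx_inv A : A^T = A -> posdefmx A -> posdefmx (invmx A).
Proof.
move=> As Ap x x0; have Au := posdefmx_unit Ap.
have y0 : invmx A *m x != 0.
  by apply: contraNneq x0 => h; rewrite -(mulKVmx Au x) h mulmx0.
have := posdefmxE Ap y0; rewrite mulKVmx // dotE trmx_mul trmx_inv As.
by [].
Qed.

(* Cauchy--Schwarz for the inner product of [A], applied to [x] and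
   [invmx A *m x]. *)
Lemma dot_posdef_lb A x : A^T = A -> posdefmx A ->
  dot x x <= opnorm2 (invmx A) * dot x (A *m x).
Proof.
move=> As Ap; have [->|x0] := eqVneq x 0; first by rewrite !dot0l mulr0.
have Au := posdefmx_unit Ap; have xx : 0 < dot x x by rewrite dot_gt0.
have := cauchy_schwarz_posdef x (invmx A *m x) As Ap.
rewrite mulKVmx // (dotC (invmx A *m x)) => h.
rewrite -(ler_pM2r xx) -expr2; apply: le_trans h _.
rewrite [leRHS]mulrAC mulrC; apply: ler_wpM2r; first exact: posdefmx_ge0.
exact: dot_opnorm2.
Qed.

End Euclid.

(** * Conjugate gradients in exact arithmetic *)

Section ExactCG.
Context {R : realType} {n : nat}.
Variables (A : 'M[R]_n) (b x0 : 'cV[R]_n).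

(* In exact arithmetic the recurrence is continued past a zero residual:
   [0 / 0 = 0] then makes it stationary with [r = p = 0]. *)
Fixpoint hs (i : nat) : 'cV[R]_n * 'cV[R]_n * 'cV[R]_n :=
  if i is j.+1 then
    let: (x, r, p) := hs j in
    let a := dot r r / dot (A *m p) p in
    let r' := r - a *: (A *m p) in
    (x + a *: p, r', r' + (dot r' r' / dot r r) *: p)
  else (x0, b - A *m x0, b - A *m x0).

Definition hs_x i := (hs i).1.1.
Definition hs_r i := (hs i).1.2.
Definition hs_p i := (hs i).2.
Definition hs_a i := dot (hs_r i) (hs_r i) / dot (A *m hs_p i) (hs_p i).
Definition hs_b i := dot (hs_r i.+1) (hs_r i.+1) / dot (hs_r i) (hs_r i).

Lemma hs_xS i : hs_x i.+1 = hs_x i + hs_a i *: hs_p i.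
Proof. by rewrite /hs_a /hs_x /hs_r /hs_p /=; case: (hs i) => [[]]. Qed.

Lemma hs_rS i : hs_r i.+1 = hs_r i - hs_a i *: (A *m hs_p i).
Proof. by rewrite /hs_a /hs_r /hs_p /=; case: (hs i) => [[]]. Qed.

Lemma hs_pS i : hs_p i.+1 = hs_r i.+1 + hs_b i *: hs_p i.
Proof. by rewrite /hs_b /hs_r /hs_p /=; case: (hs i) => [[]]. Qed.

Lemma hs_residual i : hs_r i = b - A *m hs_x i.
Proof.
elim: i => [//|i IH].
by rewrite hs_rS hs_xS IH mulmxDr -scalemxAr opprD addrA.
Qed.

Hypotheses (A_sym : A^T = A) (A_pos : posdefmx A).

Lemma hs_p_eq0 i : hs_r i = 0 -> hs_p i = 0.
Proof.
case: i => [//|i] r0; rewrite hs_pS r0.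
by rewrite /hs_b r0 dot0l mul0r scale0r addr0.
Qed.

(** The quotient can be cleared even when [p = 0]: the premise then makes the numerator zero as
    well. *)
Lemma hs_a_den i : dot (hs_r i) (hs_p i) = dot (hs_r i) (hs_r i) ->
  hs_a i * dot (A *m hs_p i) (hs_p i) = dot (hs_r i) (hs_r i).
Proof.
move=> rp; have [p0|p0] := eqVneq (hs_p i) 0.
  by rewrite -rp p0 !dot0r mulr0.
by rewrite divfK // dotC gt_eqF // posdefmxE.
Qed.

(** Turns conjugacy into orthogonality of consecutive residuals. If [hs_a i = 0], then [r = p = 0]
    and both sides vanish, since the inverse of 0 is 0. *)
Lemma hs_Ap i : dot (hs_r i) (hs_p i) = dot (hs_r i) (hs_r i) ->
  A *m hs_p i = (hs_a i)^-1 *: (hs_r i - hs_r i.+1).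
Proof.
move=> rp; have [a0|a0] := eqVneq (hs_a i) 0; last first.
  by rewrite hs_rS opprB addrC subrK scalerA mulVf // scale1r.
have := hs_a_den rp; rewrite a0 mul0r => /esym/eqP; rewrite dot_eq0 => /eqP r0.
by rewrite (hs_p_eq0 r0) mulmx0 invr0 scale0r.
Qed.

(** All relations are proved by one strong induction. The new residual is orthogonal to the old
    directions by the choice of [hs_a] and by conjugacy, hence to the old residuals, which are
    combinations of directions; conjugacy of the new direction comes last. *)
Lemma hs_orthogonal i :
  dot (hs_r i) (hs_p i) = dot (hs_r i) (hs_r i) /\
  forall j, (j < i)%N ->
    [/\ dot (hs_r i) (hs_p j) = 0, dot (hs_r i) (hs_r j) = 0 &
        dot (hs_p i) (A *m hs_p j) = 0].
Proof.
elim/ltn_ind: i => -[|i] IH; first by [].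
have rp j : (j <= i)%N -> dot (hs_r j) (hs_p j) = dot (hs_r j) (hs_r j).
  by move=> ji; case: (IH j ji).
have [rpi orth] := IH i (ltnSn i).
have r'p j : (j <= i)%N -> dot (hs_r i.+1) (hs_p j) = 0.
  rewrite leq_eqVlt hs_rS dotBl dotZl => /predU1P[->|ji].
    by rewrite hs_a_den // rpi subrr.
  have [-> _ pAp] := orth j ji.
  by rewrite dot_symmx // pAp mulr0 subrr.
have r'r j : (j <= i)%N -> dot (hs_r i.+1) (hs_r j) = 0.
  case: j => [_|j ji]; first exact: (r'p 0).
  have -> : hs_r j.+1 = hs_p j.+1 - hs_b j *: hs_p j by rewrite hs_pS addrK.
  by rewrite dotBr dotZr (r'p _ ji) (r'p _ (ltnW ji)) mulr0 subrr.
split=> [|j ji]; first by rewrite hs_pS dotDr dotZr r'p // mulr0 addr0.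
split; [exact: r'p|exact: r'r|].
rewrite {1}hs_pS dotDl dotZl.
(* For [j < i], [A *m hs_p j] is a combination of two residuals already known to be orthogonal to
   [hs_r i.+1]. For [j = i], the coefficient [hs_b i] makes the two terms cancel. *)
move: ji; rewrite ltnS leq_eqVlt => /predU1P[->|ji]; last first.
  have [_ _ ->] := orth j ji.
  rewrite hs_Ap; last exact/rp/ltnW.
  by rewrite dotZr dotBr (r'r _ ji) (r'r _ (ltnW ji)) subrr !mulr0 addr0.
have [r0|r0] := eqVneq (hs_r i) 0.
  by rewrite (hs_p_eq0 r0) mulmx0 !dot0r mulr0 addr0.
have rr : dot (hs_r i) (hs_r i) != 0 by rewrite dot_eq0.
rewrite {1}hs_Ap // dotZr dotBr r'r // /hs_b.
have ad := hs_a_den rpi; rewrite dotC in ad.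
have a0 : hs_a i != 0 by apply: contraNneq rr => a0; rewrite -ad a0 mul0r.
rewrite -ad in rr *.
have d0 : dot (hs_p i) (A *m hs_p i) != 0.
  by apply: contraNneq rr => ->; rewrite mulr0.
by field; rewrite a0 d0.
Qed.

(** Otherwise the first [n.+1] residuals are nonzero and orthogonal: their Gram matrix is diagonal
    and invertible, of rank [n.+1], although the residuals have only [n] coordinates. *)
Lemma hs_finite : exists2 m, (m <= n)%N & hs_r m = 0.
Proof.
have [i /eqP ri|no] := pickP (fun i : 'I_n.+1 => hs_r i == 0).
  by exists i => //; rewrite -ltnS.
pose M := \matrix_(i < n.+1) (hs_r i)^T.
have MM : M *m M^T = diag_mx (\row_i dot (hs_r i) (hs_r i)).
  apply/matrixP => i j; rewrite !mxE.
  have -> : \sum_k M i k * M^T k j = dot (hs_r i) (hs_r j).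
    by apply: eq_bigr => k _; rewrite !mxE.
  case: eqVneq => [<-|ij]; first by rewrite mulr1n.
  rewrite mulr0n; move: ij; rewrite -val_eqE neq_ltn => /orP[] ij.
    by rewrite dotC; have [_ /(_ _ ij)[]] := hs_orthogonal j.
  by have [_ /(_ _ ij)[]] := hs_orthogonal i.
have : \rank (M *m M^T) = n.+1.
  apply/eqP; rewrite -/(row_free _) row_free_unit unitmxE MM det_diag unitfE.
  by apply/prodf_neq0 => i _; rewrite mxE dot_eq0 no.
move=> rk; have := leq_trans (mxrankM_maxl M M^T) (rank_leq_col M).
by rewrite rk ltnn.
Qed.

Lemma hs_rp i : dot (hs_r i) (hs_p i) = dot (hs_r i) (hs_r i).
Proof. by case: (hs_orthogonal i). Qed.

Lemma hs_norm_rp i : norm2 (hs_r i) <= norm2 (hs_p i).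
Proof.
have [->|r0] := eqVneq (hs_r i) 0; first by rewrite norm2_0 norm2_ge0.
have rp : 0 < norm2 (hs_r i) by rewrite norm2_gt0.
rewrite -(ler_pM2l rp) -expr2 norm2_sqr -hs_rp.
by apply: le_trans (ler_norm _) _; exact: cauchy_schwarz.
Qed.

Hypothesis A_le1 : opnorm2 A <= 1.

Let B := invmx A.
Let K := opnorm2 B.

(** [dot r (B *m r)] is the squared energy norm of the error. One step lowers it by exactly
    [hs_a i * dot (hs_r i) (hs_r i)]. *)
Lemma hs_energy_le i :
  dot (hs_r i.+1) (B *m hs_r i.+1) <= dot (hs_r i) (B *m hs_r i).
Proof.
have Au := posdefmx_unit A_pos.
have Bs : B^T = B by rewrite trmx_inv A_sym.
rewrite hs_rS mulmxBr -scalemxAr mulKmx // !dotBl !dotBr !dotZl !dotZr.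
rewrite (dot_symmx (hs_p i) (B *m _)) // mulKVmx // (dotC (hs_p i)) hs_rp.
rewrite hs_a_den ?hs_rp // subrr subr0 gerBl.
by rewrite mulr_ge0 ?divr_ge0 ?dot_ge0 // dotC posdefmx_ge0.
Qed.

(** Residual norms need not decrease, but the energy does, and it lies between [dot r r] and
    [K * dot r r] because [opnorm2 A <= 1]. *)
Lemma hs_r_bound i j : (i <= j)%N ->
  dot (hs_r j) (hs_r j) <= K * dot (hs_r i) (hs_r i).
Proof.
move=> ij; have Au := posdefmx_unit A_pos.
have Bs : B^T = B by rewrite trmx_inv A_sym.
have := dot_posdef_lb (hs_r j) Bs (posdefmx_inv A_sym A_pos).
rewrite invmxK => h; apply: le_trans h _.
apply: (@le_trans _ _ (dot (hs_r j) (B *m hs_r j))).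
  by rewrite ler_piMl // posdefmx_ge0 //; exact: posdefmx_inv.
apply: (@le_trans _ _ (dot (hs_r i) (B *m hs_r i))); last exact: dot_opnorm2.
rewrite -(subnK ij); elim: (j - i)%N => [//|k]; rewrite addSn.
exact/le_trans/hs_energy_le.
Qed.

(** Gives both the upper bound on the step length and the lower bound on the divisor of [hs_a]. *)
Lemma hs_den_lb i :
  dot (hs_r i) (hs_r i) <= K * dot (A *m hs_p i) (hs_p i).
Proof.
rewrite -norm2_sqr; apply: (@le_trans _ _ (norm2 (hs_p i) ^+ 2)).
  by rewrite ler_pXn2r ?nnegrE ?norm2_ge0 // hs_norm_rp.
by rewrite norm2_sqr (dotC (A *m _)) dot_posdef_lb.
Qed.

(** By conjugacy with the previous direction, the energy of [p] is that of [r] minus [hs_b i ^+ 2]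
    times the energy of the previous direction, so it is at most the energy of [r]. *)
Lemma hs_p_bound i : dot (hs_p i) (hs_p i) <= K * dot (hs_r i) (hs_r i).
Proof.
have [r0|r0] := eqVneq (hs_r i) 0; first by rewrite hs_p_eq0 // r0 dot0l mulr0.
(* Were [K] negative, [hs_r_bound] with equal indices would force the residual to vanish. *)
have K0 : 0 <= K.
  rewrite leNgt; apply: contraNN r0 => K0; have := hs_r_bound (leqnn i).
  rewrite -dot_eq0 eq_le dot_ge0 andbT => h; apply: le_trans h _.
  by rewrite nmulr_rle0 // dot_ge0.
apply: le_trans (dot_posdef_lb _ A_sym A_pos) _; apply: ler_wpM2l => //.
apply: (@le_trans _ _ (dot (hs_r i) (A *m hs_r i))); last first.
  by apply: le_trans (dot_opnorm2 _ _) _; rewrite ler_piMl ?dot_ge0.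
case: i {r0} => [//|i].
have [_ /(_ i (ltnSn i))[_ _]] := hs_orthogonal i.+1.
rewrite {1}hs_pS dotDl dotZl => /eqP; rewrite addr_eq0 => /eqP rAp.
rewrite hs_pS mulmxDr -scalemxAr !dotDl !dotDr !dotZl !dotZr.
rewrite -(dot_symmx (hs_p i) (hs_r i.+1)) // (dotC (A *m _)) rAp.
have := mulr_ge0 (sqr_ge0 (hs_b i)) (posdefmx_ge0 (hs_p i) A_pos).
by lra.
Qed.

Hypothesis K_ge0 : 0 <= K.

Lemma hs_a_bound i : `|hs_a i| <= K.
Proof.
have [r0|r0] := eqVneq (hs_r i) 0.
  by rewrite /hs_a r0 dot0l mul0r normr0.
have p0 : hs_p i != 0.
  by apply: contraNneq r0 => p0; rewrite -dot_eq0 -hs_rp p0 dot0r.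
have den : 0 < dot (A *m hs_p i) (hs_p i) by rewrite dotC posdefmxE.
rewrite ger0_norm; last by rewrite divr_ge0 ?dot_ge0 // ltW.
by rewrite ler_pdivrMr // hs_den_lb.
Qed.

Lemma hs_b_bound i : `|hs_b i| <= K.
Proof.
have [r0|r0] := eqVneq (hs_r i) 0.
  by rewrite /hs_b r0 dot0l invr0 mulr0 normr0.
rewrite ger0_norm; last by rewrite divr_ge0 ?dot_ge0.
by rewrite ler_pdivrMr ?dot_gt0 // hs_r_bound.
Qed.

Lemma hs_x_bound i : norm2 (hs_x i) <= K * (norm2 b + norm2 (hs_r i)).
Proof.
have Au := posdefmx_unit A_pos.
have -> : hs_x i = B *m (b - hs_r i) by rewrite hs_residual subKr mulKmx.
apply: le_trans (opnorm2_ub _ _) _.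
by rewrite ler_wpM2l // norm2B.
Qed.

End ExactCG.

(** * Propagation of rounding errors *)

Section Accuracy.
Context {R : realType}.
Variables (F : fp_system R) (u omega C M H d : R) (N : nat).
Hypotheses (u_ge0 : 0 <= u) (omega_ge0 : 0 <= omega).
Hypothesis fl_err : forall z y, fl F z = Some y -> `|y - z| <= u * `|z| + omega.
Hypotheses (M_ge1 : 1 <= M) (M_lt_H : M + 1 <= H).
Hypotheses (d_gt0 : 0 < d) (d_le1 : d <= 1).
Hypothesis C_ge : 4 * M / d ^+ 2 + 3 * M + 3 <= C.
Hypothesis prec : (u + omega) * C ^+ N <= d / 4.
Implicit Types (x y v w : stored R) (s t : R) (k : nat).

Definition safe x := forall z, exacts x z -> `|z| <= H -> fl F z <> None.

Definition err k := (u + omega) * C ^+ k.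

(* Conditional on the range of the exact results behind [x], so that accuracy is
   inherited by every operation even at indices that the algorithm need not
   reach, where the range assumption says nothing. *)
Definition accurate k x t :=
  safe x -> exists2 y, fpval x = Some y & `|y - t| <= err k.

Let C_ge3 : 3 * M + 3 <= C.
Proof.
apply: le_trans C_ge; rewrite -addrA lerDr.
by rewrite divr_ge0 ?exprn_ge0 ?mulr_ge0 ?ltW // (lt_le_trans ltr01).
Qed.

Let C_ge1 : 1 <= C. Proof. by have := C_ge3; have := M_ge1; lra. Qed.

Lemma err_ge0 k : 0 <= err k.
Proof. by rewrite mulr_ge0 ?addr_ge0 // exprn_ge0 // (le_trans ler01). Qed.

Lemma errS k : err k.+1 = C * err k.
Proof. by rewrite /err exprS mulrCA. Qed.

Lemma err_le k l : (k <= l)%N -> err k <= err l.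
Proof. by move=> kl; rewrite ler_wpM2l ?addr_ge0 // ler_weXn2l. Qed.

Lemma err_small k : (k <= N)%N -> err k <= d / 4.
Proof. by move=> kN; apply: le_trans (err_le kN) prec. Qed.

Lemma accurate_le k l x t : (k <= l)%N -> accurate k x t -> accurate l x t.
Proof.
move=> kl h /h[y sy yt]; exists y => //; exact: le_trans yt (err_le kl).
Qed.

(** Serves for input data, and also for a stored iterate taken as the exact starting point of its
    own test. *)
Lemma accurate_eq k x t : fpval x = Some t -> accurate k x t.
Proof. by move=> st _; exists t => //; rewrite subrr normr0 err_ge0. Qed.

Lemma exacts_round o (h : set R) : (h `<=` exacts (round_exact F o h))%classic.
Proof. by move=> z hz; case: o => [t|] //=; left. Qed.

(** The divisors occur in the evaluation of the next iterate and direction; through this inclusion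
    they inherit the range assumption. *)
Lemma exacts_muladd (c : bool) y x w :
  (exacts x `<=` exacts (fmuladd F c y x w))%classic.
Proof.
move=> z xz; case: c => /=; first by apply: exacts_round; left; right.
by apply: exacts_round; right; apply: exacts_round; left.
Qed.

Lemma safe_round o (h : set R) x : (exacts x `<=` h)%classic ->
  safe (round_exact F o h) -> safe x.
Proof.
by move=> sh so z /sh hz; apply: so; case: o => [t|] //=; left.
Qed.

Lemma accurate_nonzero k x t : (k <= N)%N -> accurate k x t -> d <= t -> safe x ->
  finite_nonzero x.
Proof.
move=> kN hy dt /hy[z yz zt]; exists z => //; apply/eqP => z0.
move: zt; rewrite z0 sub0r normrN => /le_trans /(_ (err_small kN)).
by have := ler_norm t; have := d_gt0; move: dt; lra.
Qed.

(** The common step of all operations: [e] is the propagated error, and [err k * (M + 1)] covers the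
    new rounding error. *)
Lemma round_accurate k z t e (h : set R) : (k < N)%N -> `|z - t| <= e ->
  e + err k * (M + 1) <= err k.+1 -> `|t| <= M ->
  safe (round_exact F (Some z) h) ->
  exists2 y, fl F z = Some y & `|y - t| <= err k.+1.
Proof.
move=> kN zt ek tM sz; have e1 : err k.+1 <= d / 4 := err_small kN.
(* The propagated error is at most [err k.+1 <= d / 4 < 1], so the value to be rounded stays within
   the range bound [H]. *)
have zM : `|z| <= M + 1.
  have -> : z = z - t + t by rewrite subrK.
  apply: le_trans (ler_normD _ _) _.
  have := mulr_ge0 (err_ge0 k) (addr_ge0 (le_trans ler01 M_ge1) ler01).
  by have := d_le1; lra.
case fz : (fl F z) => [y|]; last first.
  by case: (sz z _ (le_trans zM M_lt_H)) => //; right.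
exists y => //; have := fl_err fz.
have uz : u * `|z| <= u * (M + 1) by rewrite ler_wpM2l.
have oz : omega <= omega * (M + 1) by rewrite ler_peMr // lerDr (le_trans ler01).
have rk : (u + omega) * (M + 1) <= err k * (M + 1).
  rewrite ler_wpM2r ?addr_ge0 ?(le_trans ler01) // -[leLHS]mulr1.
  exact: (@err_le 0).
have -> : y - t = y - z + (z - t) by rewrite addrA subrK.
move=> yz; apply: le_trans (ler_normD _ _) _.
by move: rk; rewrite mulrDl; lra.
Qed.

(** Budget of every operation but division: [2 * M + 1] for propagation and [M + 1] for rounding
    make [3 * M + 2], below [C]. *)
Let step3 k e : e <= (2 * M + 1) * err k -> e + err k * (M + 1) <= err k.+1.
Proof.
move=> he; have := ler_wpM2r (err_ge0 k) C_ge3; have := err_ge0 k.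
by rewrite errS; lra.
Qed.

Let norm_err2 k s t a b : (k <= N)%N -> `|a - s| <= err k -> `|b - t| <= err k ->
  `|s| <= M -> `|t| <= M -> `|a * b - s * t| <= (2 * M + 1) * err k.
Proof.
move=> kN as_ bt sM tM.
have -> : a * b - s * t = (a - s) * (b - t) + (a - s) * t + s * (b - t) by ring.
have e1 := err_small kN; have e0 := err_ge0 k.
apply: le_trans (ler_normD _ _) _.
apply: le_trans (lerD (ler_normD _ _) (lexx _)) _.
rewrite !normrM.
have h1 : `|a - s| * `|b - t| <= err k * 1.
  by apply: ler_pM => //; apply: le_trans bt _; have := d_le1; lra.
have h2 : `|a - s| * `|t| <= err k * M by apply: ler_pM.
have h3 : `|s| * `|b - t| <= M * err k by apply: ler_pM.
by lra.
Qed.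

Lemma accurate_add k x y s t : (k < N)%N -> accurate k x s -> accurate k y t ->
  `|s + t| <= M -> accurate k.+1 (fadd F x y) (s + t).
Proof.
move=> kN hx hy stM sf.
have [|a xa as_] := hx; first by apply: safe_round sf => z; left.
have [|b yb bt] := hy; first by apply: safe_round sf => z; right.
move: sf; rewrite /fadd xa yb.
move=> /(@round_accurate _ _ _ (err k + err k) _ kN); apply => //.
  have -> : a + b - (s + t) = (a - s) + (b - t) by ring.
  exact: le_trans (ler_normD _ _) (lerD as_ bt).
apply: step3; have := ler_wpM2r (err_ge0 k) M_ge1; have := err_ge0 k; lra.
Qed.

Lemma accurate_sub k x y s t : (k < N)%N -> accurate k x s -> accurate k y t ->
  `|s - t| <= M -> accurate k.+1 (fsub F x y) (s - t).
Proof.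
move=> kN hx hy stM sf.
have [|a xa as_] := hx; first by apply: safe_round sf => z; left.
have [|b yb bt] := hy; first by apply: safe_round sf => z; right.
move: sf; rewrite /fsub xa yb.
move=> /(@round_accurate _ _ _ (err k + err k) _ kN); apply => //.
  have -> : a - b - (s - t) = (a - s) - (b - t) by ring.
  exact: le_trans (ler_normB _ _) (lerD as_ bt).
apply: step3; have := ler_wpM2r (err_ge0 k) M_ge1; have := err_ge0 k; lra.
Qed.

Lemma accurate_mul k x y s t : (k < N)%N -> accurate k x s -> accurate k y t ->
  `|s| <= M -> `|t| <= M -> `|s * t| <= M -> accurate k.+1 (fmul F x y) (s * t).
Proof.
move=> kN hx hy sM tM stM sf.
have [|a xa as_] := hx; first by apply: safe_round sf => z; left.
have [|b yb bt] := hy; first by apply: safe_round sf => z; right.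
move: sf; rewrite /fmul xa yb.
move=> /(@round_accurate _ _ _ ((2 * M + 1) * err k) _ kN); apply => //.
  by apply: (norm_err2 (ltnW kN)) => //.
exact: step3.
Qed.

(** The stored divisor stays above [d / 2]. The numerators differ by at most [2 * M * err k] over a
    common denominator of at least [d ^+ 2 / 2], whence the term [4 * M / d ^+ 2] in the bound on
    [C]. *)
Lemma accurate_div k x y s t : (k < N)%N -> accurate k x s -> accurate k y t ->
  `|s| <= M -> `|t| <= M -> d <= t -> `|s / t| <= M ->
  accurate k.+1 (fdiv F x y) (s / t).
Proof.
move=> kN hx hy sM tM dt stM sf.
have [|a xa as_] := hx; first by apply: safe_round sf => z; left.
have [|b yb bt] := hy; first by apply: safe_round sf => z; right.
have e1 := err_small (ltnW kN); have e0 := err_ge0 k.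
have bd : d / 2 <= b.
  by move: bt; rewrite ler_norml => /andP[? _]; have := d_gt0; lra.
have b0 : 0 < b by have := d_gt0; lra.
have t0 : 0 < t by have := d_gt0; lra.
move: sf; rewrite /fdiv xa yb (gt_eqF b0).
move=> /(@round_accurate _ _ _ (4 * M / d ^+ 2 * err k) _ kN); apply => //.
  have -> : a / b - s / t = ((a - s) * t - s * (b - t)) / (b * t).
    by field; rewrite !gt_eqF.
  have bt0 : 0 < b * t by rewrite mulr_gt0.
  rewrite normrM [`|(b * t)^-1|]gtr0_norm ?invr_gt0 // ler_pdivrMr //.
  apply: (@le_trans _ _ (2 * M * err k)).
    apply: le_trans (ler_normB _ _) _; rewrite !normrM.
    have h2 : `|a - s| * `|t| <= err k * M by apply: ler_pM.
    have h3 : `|s| * `|b - t| <= M * err k by apply: ler_pM.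
    by lra.
  (* Isolates two factors that are each at least 1, from [d / 2 <= b] and [d <= t]. *)
  have -> : 4 * M / d ^+ 2 * err k * (b * t)
      = 2 * M * err k * (2 * b / d * (t / d)).
    by field; rewrite gt_eqF.
  apply: ler_peMr.
    exact: mulr_ge0 (mulr_ge0 (ler0n _ 2) (le_trans ler01 M_ge1)) e0.
  apply: mulr_ege1; rewrite ler_pdivlMr // mul1r //; lra.
rewrite errS -[C * _]addr0; have := ler_wpM2r e0 C_ge.
have := mulr_ge0 (le_trans ler01 M_ge1) e0; lra.
Qed.

(** The accumulator may be one level worse than the factors, because a separate product costs one
    level before the addition. In the fused form the product error still fits in [err k.+1], so both
    forms end at the same level. *)
Lemma accurate_muladd c k v x w r s t : (k.+1 < N)%N ->
  accurate k.+1 v r -> accurate k x s -> accurate k w t ->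
  `|s| <= M -> `|t| <= M -> `|s * t| <= M -> `|r + s * t| <= M ->
  accurate k.+2 (fmuladd F c v x w) (r + s * t).
Proof.
move=> kN hv hx hw sM tM stM rM; case: c => /=; last first.
  by apply: accurate_add => //; apply: accurate_mul => //; exact: ltnW.
move=> sf.
have [|e ve er] := hv; first by apply: safe_round sf => z; left; left.
have [|a xa as_] := hx; first by apply: safe_round sf => z; left; right.
have [|b wb bt] := hw; first by apply: safe_round sf => z; right.
move: sf; rewrite ve xa wb.
move=> /(@round_accurate _ _ _ (2 * err k.+1) _ kN); apply=> //.
  have -> : e + a * b - (r + s * t) = (e - r) + (a * b - s * t) by ring.
  apply: le_trans (ler_normD _ _) _.
  have := norm_err2 (ltnW (ltnW kN)) as_ bt sM tM.
  have := @step3 k ((2 * M + 1) * err k) (lexx _).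
  have := mulr_ge0 (err_ge0 k) (addr_ge0 (le_trans ler01 M_ge1) ler01).
  by lra.
apply: step3; have := ler_wpM2r (err_ge0 k.+1) M_ge1; have := err_ge0 k.+1; lra.
Qed.

Lemma accurate_mulsub c k v x w r s t : (k.+1 < N)%N ->
  accurate k.+1 v r -> accurate k x s -> accurate k w t ->
  `|s| <= M -> `|t| <= M -> `|s * t| <= M -> `|r - s * t| <= M ->
  accurate k.+2 (fmulsub F c v x w) (r - s * t).
Proof.
move=> kN hv hx hw sM tM stM rM; case: c => /=; last first.
  by apply: accurate_sub => //; apply: accurate_mul => //; exact: ltnW.
move=> sf.
have [|e ve er] := hv; first by apply: safe_round sf => z; left; left.
have [|a xa as_] := hx; first by apply: safe_round sf => z; left; right.
have [|b wb bt] := hw; first by apply: safe_round sf => z; right.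
move: sf; rewrite ve xa wb.
move=> /(@round_accurate _ _ _ (2 * err k.+1) _ kN); apply=> //.
  have -> : e - a * b - (r - s * t) = (e - r) - (a * b - s * t) by ring.
  apply: le_trans (ler_normB _ _) _.
  have := norm_err2 (ltnW (ltnW kN)) as_ bt sM tM.
  have := @step3 k ((2 * M + 1) * err k) (lexx _).
  have := mulr_ge0 (err_ge0 k) (addr_ge0 (le_trans ler01 M_ge1) ler01).
  by lra.
apply: step3; have := ler_wpM2r (err_ge0 k.+1) M_ge1; have := err_ge0 k.+1; lra.
Qed.

(** * Rounding errors in inner products, matrix-vector products and residuals *)

Section AccurateVectors.
Variables (n : nat) (W : R).
Implicit Types (f g : 'I_n -> stored R) (a z : 'cV[R]_n) (c : 'I_n -> bool).
Hypotheses (n_gt0 : (0 < n)%N) (W_ge1 : 1 <= W) (W_M : W ^+ 2 <= M).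

Definition accurate_vec k f a :=
  forall i, accurate k (f i) (a i 0).

Lemma accurate_vec_le k l f a :
  (k <= l)%N -> accurate_vec k f a -> accurate_vec l f a.
Proof. by move=> kl h i; apply: accurate_le (h i). Qed.

Lemma norm_mul_leM (s t : R) : `|s| <= W -> `|t| <= W -> `|s * t| <= M.
Proof.
by move=> sW tW; rewrite normrM; apply: le_trans W_M; rewrite expr2 ler_pM.
Qed.

Lemma norm_le_M (s : R) : `|s| <= W -> `|s| <= M.
Proof.
by move=> sW; rewrite -[s]mulr1 norm_mul_leM // normr1.
Qed.

Lemma entry_le a i : norm2 a <= W -> `|a i 0| <= W.
Proof. exact/le_trans/norm2_ge. Qed.

Lemma norm_dot_leM a z : norm2 a <= W -> norm2 z <= W -> `|dot a z| <= M.
Proof.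
move=> xW yW; apply: le_trans (cauchy_schwarz _ _) _; apply: le_trans W_M.
by rewrite expr2 ler_pM ?norm2_ge0.
Qed.

(** Each term costs one level. The invariant adds the absolute values of the terms still to come, so
    no later partial sum exceeds [M]. *)
Lemma accurate_foldl c f g k l a z js (x : stored R) t :
  (k <= l)%N -> (l.+1 + size js <= N)%N ->
  accurate_vec k f a -> accurate_vec k g z -> norm2 a <= W -> norm2 z <= W ->
  accurate l.+1 x t -> `|t| + \sum_(j <- js) `|a j 0 * z j 0| <= M ->
  accurate (l.+1 + size js)
    (foldl (fun y j => fmuladd F (c j) y (f j) (g j)) x js)
    (t + \sum_(j <- js) a j 0 * z j 0).
Proof.
move=> kl lN hv hw xW yW.
elim: js l x t kl lN => [|j js IH] l x t kl lN hs tM.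
  by rewrite big_nil addr0 addn0.
rewrite big_cons /= addnS -addSn addrA.
move: tM; rewrite big_cons => tM.
have S0 : 0 <= \sum_(i <- js) `|a i 0 * z i 0| by apply: sumr_ge0.
have tj := ler_normD t (a j 0 * z j 0); have lN' : (l.+2 + size js <= N)%N.
  by move: lN; rewrite /= addnS addSn.
apply: IH => //; [exact: leqW| |lra].
apply: accurate_muladd => //.
- by apply: leq_trans lN'; rewrite leq_addr.
- exact: accurate_le (hv j).
- exact: accurate_le (hw j).
- exact/norm_le_M/entry_le.
- exact/norm_le_M/entry_le.
- by apply: norm_mul_leM; exact: entry_le.
- by lra.
Qed.

(** Length [n] costs [n] levels: one for the first product, then one for each further
    accumulation. *)
Lemma accurate_dot c f g k a z : (k + n <= N)%N ->
  accurate_vec k f a -> accurate_vec k g z -> norm2 a <= W -> norm2 z <= W ->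
  accurate (k + n) (fdot F c f g) (dot a z).
Proof.
move=> kN hv hw xW yW.
have CS : \sum_(j <- enum 'I_n) `|a j 0 * z j 0| <= M.
  rewrite big_enum; apply: le_trans (cauchy_schwarz_abs a z) _.
  by apply: le_trans W_M; rewrite expr2 ler_pM ?norm2_ge0.
have dE : dot a z = \sum_(j <- enum 'I_n) a j 0 * z j 0 by rewrite big_enum.
have : size (enum 'I_n) = n by rewrite size_enum_ord.
rewrite /fdot dE; move: CS; case: (enum 'I_n) => [|j js] CS sz.
  by move: n_gt0; rewrite -{1}sz.
have kE : (k + n)%N = (k.+1 + size js)%N by rewrite -[n in LHS]sz addSnnS.
rewrite kE in kN *; rewrite big_cons.
rewrite big_cons in CS.
apply: (@accurate_foldl _ _ _ k) => //.
have S0 : 0 <= \sum_(i <- js) `|a i 0 * z i 0| by apply: sumr_ge0.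
apply: accurate_mul => //.
- by apply: leq_trans kN; rewrite leq_addr.
- exact/norm_le_M/entry_le.
- exact/norm_le_M/entry_le.
- by lra.
Qed.

Lemma accurate_mv (c : 'I_n -> 'I_n -> bool) f k (A : 'M[R]_n) a :
  (k + n <= N)%N ->
  A^T = A -> opnorm2 A <= 1 -> accurate_vec k f a -> norm2 a <= W ->
  accurate_vec (k + n) (fmv F c A f) (A *m a).
Proof.
move=> kN As A1 hv xW i.
have -> : (A *m a) i 0 = dot (row i A)^T a.
  by rewrite mxE; apply: eq_bigr => j _; rewrite !mxE.
apply: accurate_dot => // [j|]; first by apply: accurate_eq; rewrite !mxE.
by apply: le_trans (norm2_row _ As) _; exact: le_trans A1 W_ge1.
Qed.

Lemma accurate_residual (c : 'I_n -> 'I_n -> bool) f k (A : 'M[R]_n)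
    (b : 'cV[R]_n) a : (k + n < N)%N ->
  A^T = A -> opnorm2 A <= 1 -> accurate_vec k f a -> norm2 a <= W ->
  norm2 (b - A *m a) <= W ->
  accurate_vec (k + n).+1 (fresidual F c A b f) (b - A *m a).
Proof.
move=> kN As A1 hv xW rW i.
have -> : (b - A *m a) i 0 = b i 0 - (A *m a) i 0 by rewrite !mxE.
apply: accurate_sub => //; first exact: accurate_eq.
  by apply: accurate_mv => //; exact: ltnW.
by have := norm_le_M (entry_le i rW); rewrite !mxE.
Qed.

(** * The stored CG run compared with the exact one *)

Section FloatingCG.
Variables (A : 'M[R]_n) (b x0 : 'cV[R]_n) (eps : R) (ch : cg_choice n).
Hypotheses (A_sym : A^T = A) (A_le1 : opnorm2 A <= 1).

Let x := hs_x A b x0.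
Let r := hs_r A b x0.
Let p := hs_p A b x0.

Hypothesis x_le : forall i, norm2 (x i) <= W - 2.
Hypothesis r_le : forall i, norm2 (r i) <= W.
Hypothesis p_le : forall i, norm2 (p i) <= W.
Hypothesis a_le : forall i, `|hs_a A b x0 i| <= W.
Hypothesis b_le : forall i, `|hs_b A b x0 i| <= W.

(* [n.+1] nested operations for the initial residual and [3 * n + 6] per
   iteration: three inner products, two quotients and two AXPYs in sequence. *)
Definition depth i := (n.+1 + i * (3 * n + 6))%N.

(** The stored squared norm belongs to the invariant because later quotients may reuse it; as an
    inner product of the stored residual it lies [n] levels higher. *)
Definition accurate_state k i (s : cg_state R n) :=
  [/\ accurate_vec k (cg_x s) (x i), accurate_vec k (cg_r s) (r i),
      accurate_vec k (cg_p s) (p i) &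
      accurate (k + n) (cg_rr s) (dot (r i) (r i))].

Let x_leW i : norm2 (x i) <= W.
Proof. by apply: le_trans (x_le i) _; rewrite gerBl. Qed.

Let entry_M (v : 'cV[R]_n) i : norm2 v <= W -> `|v i 0| <= M.
Proof. by move=> vW; apply/norm_le_M/entry_le. Qed.

Let Ap_le i : norm2 (A *m p i) <= W.
Proof.
apply: le_trans (opnorm2_ub _ _) _; apply: le_trans (p_le i).
by rewrite ler_piMl // norm2_ge0.
Qed.

Lemma accurate_init : (n.+1 + n <= N)%N ->
  accurate_state n.+1 0 (cg_init F ch A b x0).
Proof.
move=> nN.
have hr : accurate_vec n.+1 (cg_r (cg_init F ch A b x0)) (r 0).
  rewrite -[n.+1]/(0 + n).+1; apply: accurate_residual => //.
  - by apply: leq_trans nN; rewrite leq_addr.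
  - by move=> i; exact: accurate_eq.
  - exact: (x_leW 0).
  - exact: (r_le 0).
split=> //; first by move=> i; exact: accurate_eq.
by apply: accurate_dot => //; exact: (r_le 0).
Qed.

Section Step.
Variables (k i : nat) (c : iter_choice n) (s : cg_state R n).
Hypotheses (kN : (k + 3 * n + 6 <= N)%N) (s_acc : accurate_state k i s).
Hypothesis d_le_rr : d <= dot (r i) (r i).
Hypothesis d_le_den : d <= dot (A *m p i) (p i).

Lemma accurate_step_num : accurate (k + n) (step_num F c s) (dot (r i) (r i)).
Proof.
have [_ hr _ hrr] := s_acc; rewrite /step_num; case: reuse_num => //.
by apply: accurate_dot => //; clear -kN; lia.
Qed.

Lemma accurate_step_q : accurate_vec (k + n) (step_q F A c s) (A *m p i).
Proof.
by have [_ _ hp _] := s_acc; apply: accurate_mv => //; clear -kN; lia.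
Qed.

Lemma accurate_step_den :
  accurate (k + n + n) (step_den F A c s) (dot (A *m p i) (p i)).
Proof.
have [_ _ hp _] := s_acc; apply: accurate_dot => //; first by clear -kN; lia.
- exact: accurate_step_q.
- by apply: accurate_vec_le hp; exact: leq_addr.
Qed.

Lemma accurate_step_old : accurate (k + n) (step_old F c s) (dot (r i) (r i)).
Proof.
rewrite /step_old; case: reuse_old; first exact: accurate_step_num.
by have [_ hr _ _] := s_acc; apply: accurate_dot => //; clear -kN; lia.
Qed.

Let r_M j : `|dot (r j) (r j)| <= M.
Proof. exact: norm_dot_leM. Qed.

Lemma accurate_step_a : accurate (k + n + n).+1 (step_a F A c s) (hs_a A b x0 i).
Proof.
apply: accurate_div => //.
- by clear -kN; lia.
- by apply: accurate_le accurate_step_num; exact: leq_addr.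
- exact: accurate_step_den.
- exact: norm_dot_leM.
- exact/norm_le_M/a_le.
Qed.

Lemma accurate_step_x : accurate_vec (k + n + n).+3 (step_x F A c s) (x i.+1).
Proof.
have [hx _ hp _] := s_acc; move=> j.
have xE : x i.+1 j 0 = x i j 0 + hs_a A b x0 i * p i j 0.
  by rewrite [x i.+1]hs_xS !mxE.
rewrite xE; apply: accurate_muladd.
- by clear -kN; lia.
- by apply: accurate_le (hx j); clear -kN; lia.
- exact: accurate_step_a.
- by apply: accurate_le (hp j); clear -kN; lia.
- exact/norm_le_M/a_le.
- exact: entry_M.
- by apply: norm_mul_leM => //; exact: entry_le.
- by rewrite -xE; exact: entry_M.
Qed.

Lemma accurate_step_r : accurate_vec (k + n + n).+3 (step_r F A c s) (r i.+1).
Proof.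
have [_ hr _ _] := s_acc; move=> j.
have rE : r i.+1 j 0 = r i j 0 - hs_a A b x0 i * (A *m p i) j 0.
  by rewrite [r i.+1]hs_rS !mxE.
rewrite rE; apply: accurate_mulsub.
- by clear -kN; lia.
- by apply: accurate_le (hr j); clear -kN; lia.
- exact: accurate_step_a.
- by apply: accurate_le (@accurate_step_q j); clear -kN; lia.
- exact/norm_le_M/a_le.
- exact: entry_M.
- by apply: norm_mul_leM => //; exact: entry_le.
- by rewrite -rE; exact: entry_M.
Qed.

Lemma accurate_step_rr :
  accurate ((k + n + n).+3 + n) (step_rr F A c s) (dot (r i.+1) (r i.+1)).
Proof.
by apply: accurate_dot => //; [clear -kN; lia|exact: accurate_step_r..].
Qed.

Lemma accurate_step_b :
  accurate ((k + n + n).+3 + n).+1 (step_b F A c s) (hs_b A b x0 i).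
Proof.
apply: accurate_div => //.
- by clear -kN; lia.
- exact: accurate_step_rr.
- by apply: accurate_le accurate_step_old; clear -kN; lia.
- exact/norm_le_M/b_le.
Qed.

Lemma accurate_step_p : accurate_vec (k + (3 * n + 6)) (step_p F A c s) (p i.+1).
Proof.
have [_ _ hp _] := s_acc; move=> j.
have pE : p i.+1 j 0 = r i.+1 j 0 + hs_b A b x0 i * p i j 0.
  by rewrite [p i.+1]hs_pS !mxE.
rewrite pE; have -> : (k + (3 * n + 6))%N = ((k + n + n).+3 + n).+3.
  by clear -kN; lia.
apply: accurate_muladd.
- by clear -kN; lia.
- by apply: accurate_le (@accurate_step_r j); clear -kN; lia.
- exact: accurate_step_b.
- by apply: accurate_le (hp j); clear -kN; lia.
- exact/norm_le_M/b_le.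
- exact: entry_M.
- by apply: norm_mul_leM => //; exact: entry_le.
- by rewrite -pE; exact: entry_M.
Qed.

Lemma accurate_step : accurate_state (k + (3 * n + 6)) i.+1 (cg_step F A c s).
Proof.
split.
- by apply: accurate_vec_le accurate_step_x; clear -kN; lia.
- by apply: accurate_vec_le accurate_step_r; clear -kN; lia.
- exact: accurate_step_p.
- by apply: accurate_le accurate_step_rr; clear -kN; lia.
Qed.

End Step.

Lemma accurate_cg_at i : (depth i + n <= N)%N ->
  (forall j, (j < i)%N -> d <= dot (r j) (r j) /\ d <= dot (A *m p j) (p j)) ->
  accurate_state (depth i) i (cg_at F ch A b x0 i).
Proof.
elim: i => [nN _|i IH nN hd].
  by rewrite /depth mul0n addn0 in nN *; exact: accurate_init.
have [d1 d2] := hd i (ltnSn i).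
have dS : depth i.+1 = (depth i + (3 * n + 6))%N.
  by rewrite /depth mulSn addnA addnAC.
rewrite dS in nN *; apply: accurate_step => //; first by clear -nN; lia.
by apply: IH => [|j ji]; [clear -nN; lia|apply/hd/ltnW].
Qed.

(** The reference value is taken at the stored iterate, not at the exact one, so depth is counted
    afresh: [n.+1] for the residual, [n] for its squared norm, 2 for the scaled subtraction. *)
Lemma accurate_test i (xh : 'cV[R]_n) :
  (2 * n + 3 <= N)%N -> 0 <= eps0 eps <= 1 ->
  (forall j, fpval (cg_x (cg_at F ch A b x0 i) j) = Some (xh j 0)) ->
  norm2 xh <= W -> norm2 (b - A *m xh) <= W ->
  accurate (2 * n + 3) (cg_test F ch A b x0 eps i)
    (dot (b - A *m xh) (b - A *m xh) - eps0 eps ^+ 2 / 4 * dot xh xh).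
Proof.
move=> nN /andP[e0 e1] xhE xhW rW.
have hx : accurate_vec 0 (cg_x (cg_at F ch A b x0 i)) xh.
  by move=> j; exact: accurate_eq.
have e2 : 0 <= eps0 eps ^+ 2 / 4 <= 1.
  have := exprn_ile1 2 e0 e1; have := sqr_ge0 (eps0 eps).
  by move=> ? ?; apply/andP; split; lra.
have e2n : `|eps0 eps ^+ 2 / 4| <= 1 by rewrite ger0_norm; case/andP: e2.
have dx0 := dot_ge0 xh; have dr0 := dot_ge0 (b - A *m xh).
have dxM : dot xh xh <= M.
  by apply: le_trans (ler_norm _) _; exact: norm_dot_leM.
have drM : dot (b - A *m xh) (b - A *m xh) <= M.
  by apply: le_trans (ler_norm _) _; exact: norm_dot_leM.
have pr0 : 0 <= eps0 eps ^+ 2 / 4 * dot xh xh.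
  by rewrite mulr_ge0 //; case/andP: e2.
have prM : eps0 eps ^+ 2 / 4 * dot xh xh <= dot xh xh.
  by rewrite ler_piMl //; case/andP: e2.
have -> : (2 * n + 3)%N = (n + n.+1).+2 by clear -nN; lia.
apply: accurate_mulsub.
- by clear -nN; lia.
- apply: (@accurate_le (n.+1 + n)%N); first by clear -nN; lia.
  apply: accurate_dot => //; first by clear -nN; lia.
    by apply: (@accurate_residual _ _ 0%N) => //; clear -nN; lia.
  by apply: (@accurate_residual _ _ 0%N) => //; clear -nN; lia.
- exact: accurate_eq.
- apply: (@accurate_le (0 + n)%N); first by clear -nN; lia.
  by apply: accurate_dot => //; clear -nN; lia.
- exact: le_trans e2n M_ge1.
- exact: norm_dot_leM.
- by rewrite ger0_norm //; lra.
- by rewrite ler_norml; apply/andP; split; lra.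
Qed.

(** * Termination and soundness of the stopping test *)

Section Termination.
Local Notation eps0 := (eps0 eps).
Local Notation state i := (cg_at F ch A b x0 i).
Variable m : nat.
Hypotheses (A_ge : 2^-1 <= opnorm2 A) (b_norm : 2^-1 <= norm2 b <= 1).
Hypotheses (eps0_gt0 : 0 < eps0) (eps0_le1 : eps0 <= 1).
Hypotheses (depth_le : (depth m + n <= N)%N) (test_depth_le : (2 * n + 3 <= N)%N).
Hypothesis vec_err : Num.sqrt n%:R * err N <= eps0 / 40.
Hypothesis test_err : err N <= eps0 ^+ 2 / 800.
Hypothesis r_m : norm2 (r m) < eps0 / 10.
Hypothesis r_j : forall j, (j < m)%N -> eps0 / 10 <= norm2 (r j).
Hypothesis divisors_ge : forall j, (j < m)%N ->
  d <= dot (r j) (r j) /\ d <= dot (A *m p j) (p j).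
Hypothesis range : forall i, cg_reached F ch A b x0 eps i ->
  forall z : R, cg_exacts F ch A b x0 eps i z -> `|z| <= H -> fl F z <> None.

Let state_acc i : (i <= m)%N -> accurate_state (depth i) i (state i).
Proof.
move=> im; apply: accurate_cg_at => [|j ji]; last first.
  by apply: divisors_ge; exact: leq_trans ji im.
apply: leq_trans depth_le; rewrite leq_add2r leq_add2l.
by rewrite leq_mul2r im orbT.
Qed.

Let depth_leN i : (i <= m)%N -> (depth i <= N)%N.
Proof.
move=> im; apply: leq_trans (leq_trans (leq_addr n _) depth_le).
by rewrite leq_add2l leq_mul2r im orbT.
Qed.

(** Passing from entries to the norm costs the factor [sqrt n], which explains its presence in
    [delta_cst]. Safety makes each entry finite, so the default 0 is never taken. *)
Lemma cg_value k f (v : 'cV[R]_n) : (k <= N)%N -> accurate_vec k f v ->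
  (forall i, safe (f i)) ->
  exists2 vh : 'cV[R]_n, forall i, fpval (f i) = Some (vh i 0) &
    norm2 (vh - v) <= eps0 / 40.
Proof.
move=> kN fv sf; pose vh := \col_i odflt 0 (fpval (f i)).
exists vh => [i|]; first by have [y fy _] := fv i (sf i); rewrite mxE fy.
apply: le_trans vec_err; apply: norm2_le_sqrt => [|i]; first exact: err_ge0.
have [y fy yv] := fv i (sf i); rewrite !mxE fy /=.
exact: le_trans yv (err_le kN).
Qed.

Lemma cg_x_value i : (i <= m)%N -> cg_reached F ch A b x0 eps i ->
  exists2 xh : 'cV[R]_n,
    forall k : 'I_n, fpval (cg_x (state i) k) = Some (xh k 0) &
    norm2 (xh - x i) <= eps0 / 40.
Proof.
move=> im ri; have [hx _ _ _] := state_acc im.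
apply: cg_value (depth_leN im) hx _ => k z hz.
by apply: range ri _ _; right; exists k; constructor 1.
Qed.

Lemma cg_nonzero_residual j : (j < m)%N -> cg_reached F ch A b x0 eps j ->
  ~~ cg_zero_residual F ch A b x0 j.
Proof.
move=> jm rj; have [_ hr _ _] := state_acc (ltnW jm).
have [|rh rhE rhr] := cg_value (depth_leN (ltnW jm)) hr.
  by move=> k z hz; apply: range rj _ _; right; exists k; constructor 2.
apply/negP => /forallP z0; have rh0 : rh = 0.
  by apply/colP => k; have := eqP (z0 k); rewrite rhE mxE => -[].
by move: rhr; rewrite rh0 sub0r norm2N; have := r_j jm; have := eps0_gt0; lra.
Qed.

Lemma cg_test_value i (xh : 'cV[R]_n) : (i <= m)%N ->
  cg_reached F ch A b x0 eps i ->
  (forall k : 'I_n, fpval (cg_x (state i) k) = Some (xh k 0)) ->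
  norm2 (xh - x i) <= eps0 / 40 ->
  exists2 phi, fpval (cg_test F ch A b x0 eps i) = Some phi &
    `|phi - (norm2 (b - A *m xh) ^+ 2 - eps0 ^+ 2 / 4 * norm2 xh ^+ 2)|
      <= eps0 ^+ 2 / 800.
Proof.
move=> im ri xhE xhx; rewrite !norm2_sqr.
(* The slack 2 in [x_le] is spent here: one unit on the error of the iterate, one on [norm2 b] in
   the residual. *)
have xhW : norm2 xh <= W - 1.
  rewrite -(subrK (x i) xh); apply: le_trans (norm2D _ _) _.
  by have := x_le i; have := eps0_le1; lra.
have rW : norm2 (b - A *m xh) <= W.
  apply: le_trans (norm2B _ _) _; have := opnorm2_ub A xh.
  have := ler_wpM2r (norm2_ge0 xh) A_le1; case/andP: b_norm => _.
  by move: xhW; lra.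
have e01 : 0 <= eps0 <= 1 by rewrite (ltW eps0_gt0) eps0_le1.
have [||phi phiE phi_err] := accurate_test test_depth_le e01 xhE _ rW.
- by move: xhW; lra.
- by move=> z hz; apply: range ri _ _; left.
exists phi => //; apply: le_trans phi_err _; apply: le_trans test_err.
exact: err_le.
Qed.

(** The true residual is at most [eps0 / 10 + eps0 / 40 = eps0 / 8], hence the iterate has norm at
    least [1 / 2 - 1 / 8 = 3 / 8]. The exact test quantity is then at most [- 5 / 256 * eps0 ^+ 2],
    which leaves ample room for the evaluation error. *)
Lemma cg_stop_at_m : cg_reached F ch A b x0 eps m -> cg_stop F ch A b x0 eps m.
Proof.
move=> rm; have [xh xhE xhx] := cg_x_value (leqnn m) rm.
have [phi phiE phi_err] := cg_test_value (leqnn m) rm xhE xhx.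
rewrite /cg_stop phiE; move: phi_err; rewrite ler_norml => /andP[_ phi_le].
have Ax_le (v : 'cV[R]_n) : norm2 (A *m v) <= norm2 v.
  by apply: le_trans (opnorm2_ub _ _) _; rewrite ler_piMl ?norm2_ge0.
set t := norm2 (b - A *m xh) in phi_le; set y := norm2 xh in phi_le.
have t_le : t <= eps0 / 8.
  have -> : t = norm2 (r m - A *m (xh - x m)).
    by congr norm2; rewrite /r hs_residual mulmxBr opprB addrA subrK.
  apply: le_trans (norm2B _ _) _; have := Ax_le (xh - x m).
  by move: r_m xhx; lra.
have y_ge : 3 / 8 <= y.
  have : norm2 b <= t + y.
    rewrite -(subrK (A *m xh) b); apply: le_trans (norm2D _ _) _.
    by rewrite lerD2l.
  by move: t_le eps0_le1; case/andP: b_norm => + _; lra.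
have t2 : t ^+ 2 <= (eps0 / 8) ^+ 2.
  by rewrite ler_pXn2r ?nnegrE ?norm2_ge0 // divr_ge0 // ltW.
have y2 : (3 / 8) ^+ 2 <= y ^+ 2.
  by rewrite ler_pXn2r ?nnegrE ?norm2_ge0 // divr_ge0.
have := ler_wpM2l (sqr_ge0 eps0) y2.
have := exprn_gt0 2 eps0_gt0.
by move: phi_le t2; rewrite expr_div_n; lra.
Qed.

Lemma cg_stop_sound i (xh : 'cV[R]_n) : (i <= m)%N ->
  cg_reached F ch A b x0 eps i ->
  (forall k : 'I_n, fpval (cg_x (state i) k) = Some (xh k 0)) ->
  norm2 (xh - x i) <= eps0 / 40 -> cg_stop F ch A b x0 eps i ->
  xh != 0 /\ eta_A A b xh <= eps0.
Proof.
move=> im ri xhE xhx; rewrite /cg_stop.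
have [phi -> phi_err] := cg_test_value im ri xhE xhx; move=> phi_le.
have {}phi_le : norm2 (b - A *m xh) ^+ 2 <= eps0 ^+ 2 / 4 * norm2 xh ^+ 2.
  move: phi_err phi_le; rewrite ler_norml => /andP[+ _].
  by have := sqr_ge0 eps0; lra.
(* At the zero vector the inequality would read [norm2 b ^+ 2 <= 0]. *)
have xh0 : xh != 0.
  apply: contraTneq phi_le => ->.
  rewrite mulmx0 subr0 norm2_0 expr0n mulr0 -ltNge.
  by rewrite exprn_gt0 // (lt_le_trans _ (proj1 (andP b_norm))) // invr_gt0.
split=> //; have xp : 0 < norm2 xh by rewrite norm2_gt0.
have A0 : 0 < opnorm2 A by apply: lt_le_trans A_ge; rewrite invr_gt0.
rewrite /eta_A ler_pdivrMr ?mulr_gt0 //.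
have : norm2 (b - A *m xh) <= eps0 / 2 * norm2 xh.
  have e2 := mulr_ge0 (divr_ge0 (ltW eps0_gt0) (ler0n _ 2)) (norm2_ge0 xh).
  rewrite -(@ler_pXn2r _ 2) ?nnegrE ?norm2_ge0 //.
  by apply: le_trans phi_le _; rewrite exprMn expr_div_n; lra.
move/le_trans; apply; rewrite -mulrA ler_wpM2l ?(ltW eps0_gt0) //.
by rewrite ler_wpM2r ?(ltW xp).
Qed.

(** Before [m] the stored residual is nonzero, so only the stopping test can end the run. *)
Lemma cg_reached_le j : (j <= m)%N ->
  (forall l, (l < j)%N -> ~~ cg_stop F ch A b x0 eps l) ->
  cg_reached F ch A b x0 eps j.
Proof.
elim: j => [//|j IH] jm ns.
have rj : cg_reached F ch A b x0 eps j.
  by apply: IH => [|l lj]; [exact: ltnW|exact/ns/ltnW].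
move=> l; rewrite ltnS leq_eqVlt => /predU1P[->|/rj//].
by split; [exact: ns|exact: cg_nonzero_residual].
Qed.

Lemma cg_divisors j : (j < m)%N -> cg_reached F ch A b x0 eps j.+1 ->
  finite_nonzero (cg_divisor_a F ch A b x0 j) /\
  finite_nonzero (cg_divisor_b F ch A b x0 j).
Proof.
move=> jm rj; have [d1 d2] := divisors_ge jm.
have jN : (depth j + 3 * n + 6 <= N)%N.
  have := depth_leN jm; rewrite /depth mulSn; clear; lia.
(* The divisors of step [j] belong to the history of state [j.+1]: that of a coordinate of its
   iterate for the first, of its direction for the second. Any coordinate will do. *)
have sj := state_acc (ltnW jm); pose k0 := Ordinal n_gt0.
split.
- apply: accurate_nonzero _ (@accurate_step_den _ _ (iter_of ch j) _ jN sj) d2 _.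
    by move: jN; clear; lia.
  move=> z hz; apply: range rj _ _; right; exists k0; constructor 1.
  by apply: exacts_muladd; apply: exacts_round; right.
- apply: accurate_nonzero _ (@accurate_step_old _ _ (iter_of ch j) _ jN sj) d1 _.
    by move: jN; clear; lia.
  move=> z hz; apply: range rj _ _; right; exists k0; constructor 3.
  by apply: exacts_muladd; apply: exacts_round; right.
Qed.

Lemma cg_terminates : exists2 i, (i <= m)%N &
  [/\ forall j, (j < i)%N ->
        [/\ ~~ cg_stop F ch A b x0 eps j,
            ~~ cg_zero_residual F ch A b x0 j,
            finite_nonzero (cg_divisor_a F ch A b x0 j) &
            finite_nonzero (cg_divisor_b F ch A b x0 j)],
      cg_stop F ch A b x0 eps i &
      exists xh : 'cV[R]_n,
        [/\ forall k : 'I_n, fpval (cg_x (state i) k) = Some (xh k 0), xh != 0 &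
            eta_A A b xh <= eps0]].
Proof.
(* Either some test up to [m] succeeds, or none does before [m]; then [m] is reached and its test
   succeeds. *)
have [i0 i0m si0] : exists2 i, (i <= m)%N & cg_stop F ch A b x0 eps i.
  have [|no] := pselect (exists2 i, (i <= m)%N & cg_stop F ch A b x0 eps i) => //.
  exists m => //; apply/cg_stop_at_m/cg_reached_le => // l lm.
  by apply/negP => sl; apply: no; exists l => //; exact: ltnW.
have ex : exists i, cg_stop F ch A b x0 eps i by exists i0.
have [i si i_min] := ex_minnP ex.
have im : (i <= m)%N := leq_trans (i_min _ si0) i0m.
have ns j : (j < i)%N -> ~~ cg_stop F ch A b x0 eps j.
  by move=> ji; apply/negP => /i_min; rewrite leqNgt ji.
have reached j : (j <= i)%N -> cg_reached F ch A b x0 eps j.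
  move=> ji; apply: cg_reached_le; first exact: leq_trans ji im.
  by move=> l lj; apply: ns; exact: leq_trans lj ji.
exists i => //; split=> // [j ji|].
  have [_ nz] := reached i (leqnn i) j ji.
  have [da db] := cg_divisors (leq_trans ji im) (reached _ ji).
  by split => //; exact: ns.
have [xh xhE xhx] := cg_x_value im (reached i (leqnn i)).
exists xh; have [x0' etaA] := cg_stop_sound im (reached i (leqnn i)) xhE xhx si.
by [].
Qed.

End Termination.

End FloatingCG.

End AccurateVectors.
End Accuracy.

(** * The constants *)

Lemma eps0_gt0 (R : realType) (eps : R) : 0 < eps0 eps.
Proof. exact: exprz_gt0. Qed.

Lemma eps0_le (R : realType) (eps : R) : 0 < eps -> eps0 eps <= eps.
Proof.
move=> e0; rewrite /eps0 -powR_intmul //; set l := ln eps / ln 2.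
have ln2 : 0 < ln 2 :> R by rewrite ln_gt0 // ltr1n.
have eps_l : 2 `^ l = eps :> R.
  by rewrite /powR pnatr_eq0 /= /l divfK ?gt_eqF // lnK.
by rewrite -[leRHS]eps_l ler_powR ?ler1n // floor_le.
Qed.

Lemma depth_le_N n m : (0 < n)%N -> (m <= n)%N -> (depth n m + n <= N_cst n)%N.
Proof.
move=> n0 mn; rewrite /depth /N_cst !expnS expn0 !muln1.
have h1 : (m * (3 * n + 6) <= n * (3 * n + 6))%N by rewrite leq_mul2r mn orbT.
(* The depth is at most [3 * n ^ 2 + 8 * n + 1]; linear arithmetic needs the ordering of the
   monomials to compare it with [N_cst n]. *)
have h2 : (n <= n * n)%N by rewrite leq_pmulr.
have h3 : (n * n <= n * (n * n))%N by rewrite leq_mul2l h2 orbT.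
by rewrite mulnDr in h1; lia.
Qed.

Lemma test_depth_le_N n : (0 < n)%N -> (2 * n + 3 <= N_cst n)%N.
Proof.
move=> n0; apply: leq_trans (depth_le_N n0 (leqnn n)).
by rewrite /depth; nia.
Qed.

Section Constants.
Context {R : realType} {n : nat}.
Variables (A : 'M[R]_n) (b x0 : 'cV[R]_n) (eps : R).
Hypotheses (A_sym : A^T = A) (A_pos : posdefmx A).
Hypotheses (A_norm : 2^-1 <= opnorm2 A <= 1) (b_norm : 2^-1 <= norm2 b <= 1).

Let K := opnorm2 (invmx A).
Let kappa := kappa2 A.
Let chi := chi A b x0.
Let U := U_cst A b x0 eps.
Let d := d_cst A eps.

Lemma norm2_b_gt0 : 0 < norm2 b.
Proof. by apply: lt_le_trans (proj1 (andP b_norm)); rewrite invr_gt0. Qed.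

(** Apply the two operator bounds to [b = A *m (invmx A *m b)] and divide by [norm2 b > 0]. *)
Lemma kappa2_ge1 : 1 <= kappa.
Proof.
have b0 := norm2_b_gt0.
rewrite -(ler_pM2r b0) mul1r -{1}(mulKVmx (posdefmx_unit A_pos) b).
apply: le_trans (opnorm2_ub _ _) _; rewrite /kappa /kappa2 -mulrA.
have A0 : 0 <= opnorm2 A.
  by apply: le_trans (proj1 (andP A_norm)); rewrite invr_ge0.
by rewrite ler_wpM2l // opnorm2_ub.
Qed.

Lemma opnorm2_inv_ge0 : 0 <= K.
Proof.
have A0 : 0 < opnorm2 A.
  by apply: lt_le_trans (proj1 (andP A_norm)); rewrite invr_gt0.
rewrite -(pmulr_rge0 _ A0); exact: le_trans ler01 kappa2_ge1.
Qed.

Lemma opnorm2_inv_le : K <= 2 * kappa.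
Proof.
have := ler_wpM2r opnorm2_inv_ge0 (proj1 (andP A_norm)).
rewrite -/(kappa2 A) -/kappa; lra.
Qed.

Lemma chi_ge1 : 1 <= chi.
Proof. by rewrite le_max lexx. Qed.

Lemma initial_residual_le : norm2 (b - A *m x0) <= chi.
Proof.
have b0 := norm2_b_gt0.
have h : norm2 (b - A *m x0) <= chi * norm2 b.
  by rewrite -ler_pdivrMr // le_max lexx orbT.
apply: le_trans h _; rewrite ler_piMr ?(le_trans ler01 chi_ge1) //.
by case/andP: b_norm.
Qed.

Hypothesis eps0_le1 : eps0 eps <= 1.

Lemma d_cst_gt0 : 0 < d.
Proof.
rewrite divr_gt0 ?exprn_gt0 ?eps0_gt0 // mulr_gt0 //.
exact: lt_le_trans ltr01 kappa2_ge1.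
Qed.

Lemma d_cst_le : d <= eps0 eps ^+ 2 / 200.
Proof.
have k0 : 0 < kappa := lt_le_trans ltr01 kappa2_ge1.
have -> : d = eps0 eps ^+ 2 / 200 / kappa.
  by rewrite /d /d_cst -/kappa; field; rewrite gt_eqF.
by rewrite ler_pdivrMr // ler_peMr ?divr_ge0 ?sqr_ge0 ?kappa2_ge1.
Qed.

Lemma d_cst_le1 : d <= 1.
Proof.
apply: le_trans d_cst_le _; have := eps0_gt0 eps; have := eps0_le1.
by move=> /(exprn_ile1 2 (ltW (eps0_gt0 eps))); lra.
Qed.

(** All bounds on the exact run pass through this one: [2 * kappa] bounds the inverse,
    [2 * kappa * chi] the residuals, and the leading 2 is the slack for the iterates. The only
    negative term of the difference, in [kappa ^+ 2 * chi], is absorbed because [1 <= chi]. *)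
Lemma U_cst_ge : 2 + 2 * kappa * (1 + 2 * kappa * chi) <= U.
Proof.
have k1 := kappa2_ge1; have c1 := chi_ge1.
have di : 0 <= d^-1 by rewrite invr_ge0 ltW // d_cst_gt0.
rewrite /U /U_cst /P_cst /G_cst -/d -/kappa -/chi.
have k0 : 0 <= kappa by lra.
have c0 : 0 <= chi by lra.
have h1 : 0 <= kappa * chi by rewrite mulr_ge0.
have h2 : kappa ^+ 2 * chi <= kappa ^+ 2 * chi ^+ 2.
  by rewrite ler_wpM2l ?sqr_ge0 // expr2 ler_peMr.
have h3 : 0 <= kappa * chi ^+ 2 by rewrite mulr_ge0 ?sqr_ge0.
rewrite -subr_ge0.
set lhs := (X in 0 <= X).
have -> : lhs = d^-1 + kappa * chi ^+ 2 + 4 * (kappa * chi)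
    + (kappa ^+ 2 * chi ^+ 2 - kappa ^+ 2 * chi) by rewrite /lhs; ring.
by lra.
Qed.

Lemma U_cst_ge2 : 2 <= U.
Proof.
have k0 := le_trans ler01 kappa2_ge1; have c0 := le_trans ler01 chi_ge1.
apply: le_trans U_cst_ge; rewrite lerDl.
by have kc0 := mulr_ge0 k0 c0; apply: mulr_ge0; lra.
Qed.

(** The growth condition for [M = U ^+ 2]. Half of [C_cst] pays for division; the other half is at
    least [4 * U ^+ 2], and [3 <= U ^+ 2]. *)
Lemma C_cst_ge : 4 * U ^+ 2 / d ^+ 2 + 3 * U ^+ 2 + 3 <= C_cst A b x0 eps.
Proof.
have d0 := d_cst_gt0.
have h : U ^+ 2 <= U ^+ 2 / d ^+ 2.
  rewrite ler_peMr ?sqr_ge0 // invf_ge1 ?exprn_gt0 //.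
  by rewrite exprn_ile1 ?d_cst_le1 // ltW.
have u4 : 4 <= U ^+ 2.
  have -> : 4 = 2 ^+ 2 :> R by ring.
  by rewrite ler_pXn2r ?nnegrE // (le_trans _ U_cst_ge2).
rewrite /C_cst -/U -/d; lra.
Qed.

Lemma H_cst_ge : U ^+ 2 + 1 <= H_cst A b x0 eps.
Proof.
rewrite /H_cst -/U !le_max; apply/orP; right; apply/orP; left.
by have := U_cst_ge2; lra.
Qed.

Let hs_r_le i : norm2 (hs_r A b x0 i) <= 2 * kappa * chi.
Proof.
have k1 := kappa2_ge1; have c1 := chi_ge1.
have A1 : opnorm2 A <= 1 by case/andP: A_norm.
have k0 : 0 <= kappa by lra.
have c0 : 0 <= chi by lra.
have kc0 : 0 <= 2 * kappa * chi.
  exact: mulr_ge0 (mulr_ge0 (ler0n _ 2) k0) c0.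
rewrite -(@ler_pXn2r _ 2) ?nnegrE ?norm2_ge0 //.
rewrite norm2_sqr; apply: le_trans (hs_r_bound b x0 A_sym A_pos A1 (leq0n i)) _.
have r0 : dot (hs_r A b x0 0) (hs_r A b x0 0) <= chi ^+ 2.
  rewrite -norm2_sqr ler_pXn2r ?nnegrE ?norm2_ge0 //.
  exact: initial_residual_le.
rewrite [leRHS]exprMn; apply: ler_pM; rewrite ?dot_ge0 ?opnorm2_inv_ge0 //.
apply: le_trans opnorm2_inv_le _; rewrite expr2 ler_peMr; lra.
Qed.

Let le_U t : t <= 2 * kappa * (1 + 2 * kappa * chi) -> t <= U - 2.
Proof. by have := U_cst_ge; lra. Qed.

Let kc : 1 <= kappa * chi.
Proof. by rewrite mulr_ege1 ?kappa2_ge1 ?chi_ge1. Qed.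

Let K_le_U : K <= U.
Proof.
have k1 := kappa2_ge1; have kc1 := kc.
apply: (@le_trans _ _ (U - 2)); last by lra.
apply: le_U; apply: le_trans opnorm2_inv_le _; rewrite ler_peMr; lra.
Qed.

Let kc_le_U : 2 * kappa * chi <= U.
Proof.
have k1 := kappa2_ge1; have kc1 := kc.
apply: (@le_trans _ _ (U - 2)); last by lra.
apply: le_U; have := ler_peMl (le_trans ler01 kc1) k1.
have -> : 2 * kappa * (1 + 2 * kappa * chi)
  = 2 * kappa + 4 * (kappa * (kappa * chi)) by ring.
by lra.
Qed.

Lemma hs_norm_r_le i : norm2 (hs_r A b x0 i) <= U.
Proof. exact: le_trans (hs_r_le i) kc_le_U. Qed.

(** One factor [K] passes from direction to residual, another from there to the initial residual;
    together they are at most [(2 * kappa) ^+ 2]. *)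
Lemma hs_norm_p_le i : norm2 (hs_p A b x0 i) <= U.
Proof.
have k0 := le_trans ler01 kappa2_ge1; have c0 := le_trans ler01 chi_ge1.
have kc0 : 0 <= 2 * kappa * chi := mulr_ge0 (mulr_ge0 (ler0n _ 2) k0) c0.
have A1 : opnorm2 A <= 1 by case/andP: A_norm.
apply: le_trans kc_le_U.
rewrite -(@ler_pXn2r _ 2) ?nnegrE ?norm2_ge0 // norm2_sqr.
apply: le_trans (hs_p_bound b x0 A_sym A_pos A1 i) _.
have r0 : dot (hs_r A b x0 0) (hs_r A b x0 0) <= chi ^+ 2.
  rewrite -norm2_sqr ler_pXn2r ?nnegrE ?norm2_ge0 //.
  exact: initial_residual_le.
rewrite [leRHS]exprMn expr2 -mulrA.
apply: ler_pM; rewrite ?opnorm2_inv_ge0 ?dot_ge0 ?opnorm2_inv_le //.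
apply: le_trans (hs_r_bound b x0 A_sym A_pos A1 (leq0n i)) _.
by apply: ler_pM; rewrite ?opnorm2_inv_ge0 ?dot_ge0 ?opnorm2_inv_le.
Qed.

Lemma hs_norm_a_le i : `|hs_a A b x0 i| <= U.
Proof.
exact: le_trans (hs_a_bound b x0 A_sym A_pos opnorm2_inv_ge0 i) K_le_U.
Qed.

Lemma hs_norm_b_le i : `|hs_b A b x0 i| <= U.
Proof.
have A1 : opnorm2 A <= 1 by case/andP: A_norm.
exact: le_trans (hs_b_bound b x0 A_sym A_pos A1 opnorm2_inv_ge0 i) K_le_U.
Qed.

Lemma hs_norm_x_le i : norm2 (hs_x A b x0 i) <= U - 2.
Proof.
apply: le_U; apply: le_trans (hs_x_bound b x0 A_pos opnorm2_inv_ge0 i) _.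
apply: ler_pM; rewrite ?addr_ge0 ?norm2_ge0 ?opnorm2_inv_ge0 //.
  exact: opnorm2_inv_le.
by apply: lerD => //; case/andP: b_norm.
Qed.

End Constants.

Theorem theorem4 (R : realType) (n : nat) (F : fp_system R) (u omega : R)
    (A : 'M[R]_n) (b x0 : 'cV[R]_n) (eps : R) (ch : cg_choice n)
    (A_sym : A^T = A) (A_pos : posdefmx A) (b_neq0 : b != 0)
    (A_fp : forall i j, fp_num F (A i j))
    (b_fp : forall i, fp_num F (b i 0))
    (x0_fp : forall i, fp_num F (x0 i 0))
    (A_norm : 2^-1 <= opnorm2 A <= 1)
    (b_norm : 2^-1 <= norm2 b <= 1)
    (eps_bnd : 0 < eps <= 1)
    (u_ge0 : 0 <= u) (omega_ge0 : 0 <= omega)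
    (fl_err : forall z y, fl F z = Some y -> `|y - z| <= u * `|z| + omega)
    (cg_prec : 2 * (u + omega) * C_cst A b x0 eps ^+ N_cst n
               <= delta_cst A eps)
    (test_prec : Es_cst A b x0 u omega <= eps0 eps ^+ 2 / 256)
    (eps0_fp : fp_num F (eps0 eps))
    (eps0_4_fp : fp_num F (eps0 eps ^+ 2 / 4))
    (eps0_256_fp : fp_num F (eps0 eps ^+ 2 / 256))
    (range : forall i, cg_reached F ch A b x0 eps i ->
       forall z, cg_exacts F ch A b x0 eps i z ->
       `|z| <= H_cst A b x0 eps -> fl F z <> None) :
  exists i : nat,
    [/\ (i <= n)%N,
        forall j, (j < i)%N ->
          [/\ ~~ cg_stop F ch A b x0 eps j,
              ~~ cg_zero_residual F ch A b x0 j,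
              finite_nonzero (cg_divisor_a F ch A b x0 j) &
              finite_nonzero (cg_divisor_b F ch A b x0 j)],
        cg_stop F ch A b x0 eps i &
        exists xhat : 'cV[R]_n,
          [/\ forall k, fpval (cg_x (cg_at F ch A b x0 i) k) = Some (xhat k 0),
              xhat != 0,
              eta A b xhat <= eta_A A b xhat,
              eta_A A b xhat <= eps0 eps &
              eps0 eps <= eps]].
Proof.
have n_gt0 : (0 < n)%N.
  (* In dimension zero every vector vanishes, against [b_neq0]. *)
  by case: n b b_neq0 {A A_sym A_pos A_fp b_fp x0 x0_fp A_norm b_norm ch cg_prec
    test_prec range} => // b'; rewrite flatmx0 eqxx.
have [eps_gt0 eps_le1] := andP eps_bnd.
have e_gt0 := eps0_gt0 eps; have e_le := eps0_le eps_gt0.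
have e_le1 : eps0 eps <= 1 := le_trans e_le eps_le1.
have [A_ge A_le1] := andP A_norm.
have d_gt0 := d_cst_gt0 eps A_pos A_norm b_norm.
have d_le := d_cst_le eps A_pos A_norm b_norm.
set U := U_cst A b x0 eps; set d := d_cst A eps in d_gt0 d_le.
pose e := err u omega (C_cst A b x0 eps) (N_cst n).
have e_le_delta : 2 * e <= delta_cst A eps by rewrite mulrA.
have [e_le_d e_le_sqrt] :
    2 * e <= d / 2 /\ 2 * e <= eps0 eps / (20 * Num.sqrt n%:R).
  by move: e_le_delta; rewrite !le_min => /and3P[].
have sn : 0 < Num.sqrt n%:R :> R by rewrite sqrtr_gt0 ltr0n.
have Ex : exists m, norm2 (hs_r A b x0 m) < eps0 eps / 10.
  have [m mn rm] := hs_finite b x0 A_sym A_pos.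
  by exists m; rewrite rm norm2_0 divr_gt0.
have [m m_small m_min] := ex_minnP Ex.
have mn : (m <= n)%N.
  have [l ln rl] := hs_finite b x0 A_sym A_pos.
  by apply: leq_trans ln; apply: m_min; rewrite rl norm2_0 divr_gt0.
have r_ge j : (j < m)%N -> eps0 eps / 10 <= norm2 (hs_r A b x0 j).
  by move=> jm; rewrite leNgt; apply/negP => /m_min; rewrite leqNgt jm.
have kappa1 := kappa2_ge1 A_pos A_norm b_norm.
have U_ge2 : 2 <= U := U_cst_ge2 x0 eps A_pos A_norm b_norm.
have U_ge1 : 1 <= U := le_trans (ler1n _ 2) U_ge2.
have prec : (u + omega) * C_cst A b x0 eps ^+ N_cst n <= d / 4.
  by change (e <= d / 4); lra.
have vec_err : Num.sqrt n%:R * e <= eps0 eps / 40.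
  have := ler_wpM2l (ltW sn) e_le_sqrt.
  have -> : Num.sqrt n%:R * (eps0 eps / (20 * Num.sqrt n%:R)) = eps0 eps / 20.
    by field; rewrite gt_eqF.
  by lra.
(* From [e <= d / 4] and [d <= eps0 ^+ 2 / 200]. *)
have test_err : e <= eps0 eps ^+ 2 / 800 by lra.
(* This fixes the form of [d]: the squared residual is at least [eps0 ^+ 2 / 100], and the other
   divisor can be smaller by a factor of at most [2 * kappa]. *)
have divisors_ge j : (j < m)%N -> d <= dot (hs_r A b x0 j) (hs_r A b x0 j) /\
    d <= dot (A *m hs_p A b x0 j) (hs_p A b x0 j).
  move=> /r_ge r_ge_j; set rr := dot _ _.
  have rr_ge : eps0 eps ^+ 2 / 100 <= rr.
    have -> : eps0 eps ^+ 2 / 100 = (eps0 eps / 10) ^+ 2 by field.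
    rewrite /rr -norm2_sqr ler_pXn2r ?nnegrE ?norm2_ge0 //.
    by rewrite divr_ge0 // ltW.
  split; first by have := sqr_ge0 (eps0 eps); lra.
  set den := dot _ _.
  have rr_le : rr <= 2 * kappa2 A * den.
    apply: le_trans (hs_den_lb b x0 A_sym A_pos j) _.
    apply: ler_wpM2r (opnorm2_inv_le A_pos A_norm b_norm).
    by rewrite /den dotC posdefmx_ge0.
  have k0 : 0 < kappa2 A by lra.
  have k200 : 0 < 200 * kappa2 A by lra.
  by rewrite /d /d_cst ler_pdivrMr //; lra.
(* Vectors and coefficients are bounded by [W = U], scalars and products by [M = U ^+ 2]. *)
have [i im [good stop [xh [xhE xh0 etaA]]]] :=
  cg_terminates u_ge0 omega_ge0 fl_err (exprn_ege1 2 U_ge1)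
    (H_cst_ge x0 eps A_pos A_norm b_norm) d_gt0
    (d_cst_le1 A_pos A_norm b_norm e_le1)
    (C_cst_ge x0 A_pos A_norm b_norm e_le1) prec n_gt0 U_ge1 (lexx _) A_sym A_le1
    (hs_norm_x_le x0 eps A_sym A_pos A_norm b_norm)
    (hs_norm_r_le x0 eps A_sym A_pos A_norm b_norm)
    (hs_norm_p_le x0 eps A_sym A_pos A_norm b_norm)
    (hs_norm_a_le x0 eps A_sym A_pos A_norm b_norm)
    (hs_norm_b_le x0 eps A_sym A_pos A_norm b_norm)
    A_ge b_norm e_gt0 e_le1
    (depth_le_N n_gt0 mn) (test_depth_le_N n_gt0) vec_err test_err m_small r_ge
    divisors_ge range.
exists i; split => //; first exact: leq_trans im mn.
exists xh; split => //.
have xp : 0 < norm2 xh by rewrite norm2_gt0.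
have A0 : 0 < opnorm2 A by apply: lt_le_trans A_ge; rewrite invr_gt0.
rewrite /eta /eta_A ler_wpM2l ?norm2_ge0 // lef_pV2 ?posrE ?mulr_gt0 //.
  by rewrite lerDl norm2_ge0.
by rewrite ltr_wpDr ?mulr_gt0 ?norm2_ge0.
Qed.
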